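(* Let $d\ge2$, $N,M\ge1$ be integers and let $|\psi\rangle,|\phi\rangle\in\mathbb{C}^d$ be independent Haar-random pure states with overlap $c=|\langle\psi|\phi\rangle|^2$. For the estimate-and-project strategy, let $k$ be the number of successful projections. Then the estimator of $c$ as a function of $k$ minimizing the global mean square error $\mathbb{E}[(c(k)-c)^2]$ (the posterior mean of $c$ given $k$) is $$c(k)=\frac{d+N+M(k+1)}{(d+M)(d+N)},\qquad k=0,\dots,N,$$ and the corresponding global mean square error is $$v_{ep}=\frac{(d-1)\left((d+M)^2+(d+2M)N\right)}{d(d+1)(d+M)^2(d+N)} .$$ Moreover $v_{ep}\to\frac{d-1}{d(d+1)(d+N)}$ as $M\to\infty$ with $N$ fixed, and $v_{ep}\sim\frac{6(d-1)}{d(d+1)(M+N)}$ as $M+N\to\infty$ with $M-N$ fixed.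
   Context: Estimate-and-project strategy: given $N$ copies of $|\psi\rangle$ and $M$ copies of $|\phi\rangle$, first the covariant measurement is performed on $|\phi\rangle^{\otimes M}$, i.e. one obtains an estimate $|\phi_V\rangle=V|0\rangle$, $V\in SU(d)$, with probability density $\binom{M+d-1}{d-1}|\langle\phi_V|\phi\rangle|^{2M}$ with respect to the normalized Haar measure $dV$ ($|0\rangle$ a fixed unit vector). Then $\{|\phi_V\rangle\langle\phi_V|,\ \mathbb{1}-|\phi_V\rangle\langle\phi_V|\}$ is measured on each of the $N$ copies of $|\psi\rangle$, and $k$ is the number of successful projections on $|\phi_V\rangle$. The expectation is over the states and the measurement outcomes. *)

(* Defs.v *)
From HB Require Import structures.
From mathcomp Require Import all_boot all_order all_algebra.
From mathcomp Require Import spectral.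
From mathcomp Require Import complex.
From mathcomp Require Import all_classical all_reals all_analysis.

Set Implicit Arguments.
Unset Strict Implicit.
Unset Printing Implicit Defensive.

Import Order.TTheory GRing.Theory Num.Theory.
Import numFieldNormedType.Exports.
Local Open Scope classical_set_scope.
Local Open Scope ring_scope.
Local Open Scope sesquilinear_scope.

HB.instance Definition _ (R : realType) := isPointed.Build R[i] 0.

(* Sets of complex matrices prescribing that the real or imaginary part of one
   entry lies in a Borel set.  They generate the Borel sigma-algebra of
   'M[R[i]]_(m, n), seen as the real space of dimension 2mn. *)
Definition coordinate_sets (R : realType) (m n : nat) :
    set (set 'M[R[i]]_(m, n)) :=
  [set A | exists (i : 'I_m) (j : 'I_n) (B : set R), measurable B /\
     (A = [set X : 'M[R[i]]_(m, n) | B (complex.Re (X i j))] \/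
      A = [set X : 'M[R[i]]_(m, n) | B (complex.Im (X i j))])].

Definition borelM (R : realType) (m n : nat) :=
  g_sigma_algebraType (@coordinate_sets R m n).

(* <u|v>, antilinear in u *)
Definition braket (R : realType) (d : nat) (u v : 'cV[R[i]]_d) : R[i] :=
  (u^t* *m v) 0 0.

(* |<u|v>|^2 *)
Definition overlap (R : realType) (d : nat) (u v : 'cV[R[i]]_d) : R :=
  complex.Re (`|braket u v| ^+ 2).

Definition SU (R : realType) (d : nat) : set 'M[R[i]]_d :=
  [set g | g \is unitarymx /\ \det g = 1].

(* Left invariance determines the normalized Haar measure; right invariance
   follows since SU(d) is compact. *)
Definition is_haar (R : realType) (d : nat)
    (mu : probability (borelM R d d) R) : Prop :=
  mu (@SU R d) = 1%E /\
  forall (g : 'M[R[i]]_d) (A : set (borelM R d d)),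
    SU g -> measurable A -> mu [set h : 'M[R[i]]_d | A (g *m h)] = mu A.

(* |u><u| *)
Definition projector (R : realType) (d : nat) (u : 'cV[R[i]]_d) : 'M[R[i]]_d :=
  u *m u^t*.

(* Probability <psi|Q|psi> of the outcome b of the two-outcome projective
   measurement {|u><u|, 1 - |u><u|}, where b = true stands for Q = |u><u|. *)
Definition born (R : realType) (d : nat) (u psi : 'cV[R[i]]_d) (b : bool) : R :=
  complex.Re
    (braket psi ((if b then projector u else 1%:M - projector u) *m psi)).

(* Density, with respect to the Haar measure, of the outcome of the covariant
   measurement of M copies of phi at a group element V with |phi_V> = u. *)
Definition covariant_density (R : realType) (d M : nat)
    (phi u : 'cV[R[i]]_d) : R :=
  'C(M + d - 1, d - 1)%:R * overlap u phi ^+ M.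

(* A probability space (T, P) carrying the states psi and phi, the outcome V of
   the covariant measurement and the outcomes x i of the projective
   measurements on the N copies of psi.  A Haar-random pure state is a vector
   distributed as g|0> for g Haar-distributed in SU(d).  The field ep_outcomes
   says that, given the states, (V, x) has the conditional density
     covariant_density M phi (V|0>) * \prod_i born (V|0>) psi (x i)
   with respect to the product of mu and the counting measure. *)
Record estimate_and_project (R : realType) (d N M : nat)
    (mu : probability (borelM R d d) R) (ket0 : 'cV[R[i]]_d)
    (disp : measure_display) (T : measurableType disp) (P : probability T R)
    (psi phi : {RV P >-> borelM R d 1}) (V : {RV P >-> borelM R d d})
    (x : 'I_N -> {RV P >-> bool}) : Prop := {
  ep_haar : is_haar mu;
  ep_ket0 : braket ket0 ket0 = 1;
  ep_psi : forall A : set (borelM R d 1), measurable A ->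
    P (psi @^-1` A) = mu [set g : 'M[R[i]]_d | A (g *m ket0)];
  ep_phi : forall A : set (borelM R d 1), measurable A ->
    P (phi @^-1` A) = mu [set g : 'M[R[i]]_d | A (g *m ket0)];
  ep_independent : forall A B : set (borelM R d 1),
    measurable A -> measurable B ->
    P (psi @^-1` A `&` phi @^-1` B) = (P (psi @^-1` A) * P (phi @^-1` B))%E;
  ep_outcomes : forall (A : set (borelM R d 1 * borelM R d 1 * borelM R d d))
      (b : 'I_N -> bool), measurable A ->
    P [set w | A (psi w, phi w, V w) /\ forall i, x i w = b i] =
    (\int[P]_w \int[mu]_g
       (\1_A (psi w, phi w, g) *
        (covariant_density M (phi w) (g *m ket0) *
         \prod_(i < N) born (g *m ket0) (psi w) (b i)))%:E)%E
}.

Section Estimation.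
Context (R : realType) (d N : nat).
Context (disp : measure_display) (T : measurableType disp).
Context (P : probability T R) (psi phi : {RV P >-> borelM R d 1}).
Context (x : 'I_N -> {RV P >-> bool}).

Definition successes (w : T) : nat := #|[set i : 'I_N | x i w]%SET|.

Definition mean_square_error (est : nat -> R) : \bar R :=
  'E_P[fun w => (est (successes w) - overlap (psi w) (phi w)) ^+ 2].

Definition optimal_estimator (est : nat -> R) : Prop :=
  forall est' : nat -> R,
    (mean_square_error est <= mean_square_error est')%E.

Definition posterior_mean (k : nat) : R :=
  (\int[P]_(w in [set w | successes w = k]) overlap (psi w) (phi w)) /
  fine (P [set w | successes w = k]).

End Estimation.

Definition c_ep (R : realType) (d N M k : nat) : R :=
  (d + N + M * (k + 1))%:R / ((d + M) * (d + N))%:R.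

Definition v_ep (R : realType) (d N M : nat) : R :=
  (d%:R - 1) * ((d%:R + M%:R) ^+ 2 + (d%:R + 2 * M%:R) * N%:R) /
  (d%:R * (d%:R + 1) * (d%:R + M%:R) ^+ 2 * (d%:R + N%:R)).

(* Main.v *)
(* Left invariance of the Haar measure and transitivity of SU(d), d >= 2, on unit
   vectors give E|<y|phi>|^(2n) = m_n |y|^(2n) for a Haar-random phi and every
   vector y.  Comparing the coefficients of t^2 for y = u + t psi and for
   y = u + t 'i psi, with t real and |u| = 1, yields
     (n+1) E[|<u|phi>|^(2n) |<psi|phi>|^2]
       = m_(n+1) (|psi|^2 + n |<u|psi>|^2).
   Summing over an orthonormal basis of vectors psi gives
   (n+d) m_(n+1) = (n+1) m_n, so that q = |<u|psi>|^2 has the moments of a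
   Beta(1, d-1) variable.  With n = M the same identity says that, given psi and
   the outcome u of the covariant measurement, the mean of c is
   (1 + M q)/(M + d).  Given k successes, q is Beta(k+1, N-k+d-1) distributed,
   with mean (k+1)/(N+d); this gives the posterior mean c(k).  The mean square
   error of any estimator is that of c(k) plus a weighted sum of squared
   deviations from c(k), and E c^2 - E c(k)^2 is computed from the binomial
   moments of k given q. *)

Require Import Defs.
From mathcomp Require Import all_boot all_order all_algebra complex.
From mathcomp Require Import spectral ring lra.
From mathcomp Require Import all_classical all_reals all_analysis measurable_realfun.

Import Order.TTheory GRing.Theory Num.Theory.
Import numFieldNormedType.Exports.
Local Open Scope classical_set_scope.
Local Open Scope complex_scope.
Local Open Scope ring_scope.
Local Open Scope sesquilinear_scope.

Set Implicit Arguments.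
Unset Strict Implicit.
Unset Printing Implicit Defensive.

Local Notation Re := complex.Re.
Local Notation Im := complex.Im.

(** * Complex coordinates and brakets *)

Section ComplexParts.
Variable R : realType.
Implicit Types z w : R[i].

Lemma Re_add z w : Re (z + w) = Re z + Re w.
Proof. by case: z w => [a b] [c e]. Qed.

Lemma Im_add z w : Im (z + w) = Im z + Im w.
Proof. by case: z w => [a b] [c e]. Qed.

Lemma Re_mul z w : Re (z * w) = Re z * Re w - Im z * Im w.
Proof. by case: z w => [a b] [c e]. Qed.

Lemma Im_mul z w : Im (z * w) = Re z * Im w + Im z * Re w.
Proof. by case: z w => [a b] [c e]. Qed.

Lemma Re_opp z : Re (- z) = - Re z.
Proof. by case: z. Qed.

Lemma Re_conjc z : Re z^* = Re z.
Proof. by case: z. Qed.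

Lemma Im_conjc z : Im z^* = - Im z.
Proof. by case: z. Qed.

Lemma Re_sum (I : Type) (r : seq I) (P : pred I) (F : I -> R[i]) :
  Re (\sum_(i <- r | P i) F i) = \sum_(i <- r | P i) Re (F i).
Proof. exact: (big_morph _ Re_add). Qed.

(** The squared modulus as a real polynomial in the coordinates, so that identities reduce to [ring]
    and measurability to that of real and imaginary parts. *)
Definition sqmod z : R := Re z ^+ 2 + Im z ^+ 2.

Lemma sqmod_ge0 z : 0 <= sqmod z.
Proof. by rewrite addr_ge0 ?sqr_ge0. Qed.

Lemma sqmod_conj z : sqmod z^* = sqmod z.
Proof. by rewrite /sqmod Re_conjc Im_conjc sqrrN. Qed.

Lemma sqmodM z w : sqmod (z * w) = sqmod z * sqmod w.
Proof. by rewrite /sqmod Re_mul Im_mul; ring. Qed.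

Lemma mul_conjE z : z * z^* = (sqmod z)%:C.
Proof.
by case: z => a b; rewrite /sqmod; apply/eqP; rewrite eq_complex /=;
  apply/andP; split; apply/eqP; ring.
Qed.

Lemma sqmod_eq0 z : (sqmod z == 0) = (z == 0).
Proof.
case: z => a b; rewrite /sqmod eq_complex /=.
by rewrite paddr_eq0 ?sqr_ge0// !sqrf_eq0.
Qed.

Lemma sqmod_real (a : R) : sqmod a%:C = a ^+ 2.
Proof. by rewrite /sqmod /= expr0n addr0. Qed.

End ComplexParts.

Section Braket.
Variables (R : realType) (d : nat).
Implicit Types (u v w psi : 'cV[R[i]]_d) (a : R[i]).

Lemma braketE u v : braket u v = \sum_i (u i 0)^* * v i 0.
Proof. by rewrite /braket mxE; apply: eq_bigr => i _; rewrite !mxE. Qed.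

Lemma braketDr u v w : braket u (v + w) = braket u v + braket u w.
Proof. by rewrite /braket mulmxDr mxE. Qed.

Lemma braketDl u v w : braket (u + v) w = braket u w + braket v w.
Proof. by rewrite /braket linearD/= map_mxD mulmxDl mxE. Qed.

Lemma braketZr a u v : braket u (a *: v) = a * braket u v.
Proof. by rewrite /braket -scalemxAr mxE. Qed.

Lemma braketZl a u v : braket (a *: u) v = a^* * braket u v.
Proof.
by rewrite !braketE mulr_sumr; apply: eq_bigr => i _; rewrite mxE rmorphM mulrA.
Qed.

Lemma braket_conj u v : (braket u v)^* = braket v u.
Proof.
rewrite !braketE rmorph_sum; apply: eq_bigr => i _.
by rewrite rmorphM /= conjCK mulrC.
Qed.

Lemma braket_adj (g : 'M[R[i]]_d) u v : braket u (g *m v) = braket (g^t* *m u) v.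
Proof.
by rewrite /braket mulmxA trmx_mul map_mxM map_trmx trmxK map_mxCK.
Qed.

Lemma braket_unitary (g : 'M[R[i]]_d) u v : g \is unitarymx ->
  braket (g *m u) (g *m v) = braket u v.
Proof.
move=> gU; rewrite braket_adj mulmxA.
have /unitarymxP : g^t* \is unitarymx by rewrite trmxC_unitary.
by rewrite map_trmx trmxK map_mxCK => ->; rewrite mul1mx.
Qed.

Definition sqnorm u : R := Re (braket u u).

Lemma sqnormE u : sqnorm u = \sum_i sqmod (u i 0).
Proof.
rewrite /sqnorm braketE Re_sum; apply: eq_bigr => i _.
by rewrite mulrC mul_conjE.
Qed.

Lemma sqnorm_ge0 u : 0 <= sqnorm u.
Proof. by rewrite sqnormE sumr_ge0// => i _; exact: sqmod_ge0. Qed.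

Lemma braket_sqnorm u : braket u u = (sqnorm u)%:C.
Proof.
rewrite [RHS](_ : _ = \sum_i (sqmod (u i 0))%:C).
  by rewrite braketE; apply: eq_bigr => i _; rewrite -mul_conjE mulrC.
by rewrite sqnormE (rmorph_sum (real_complex R)).
Qed.

Lemma overlapE u v : overlap u v = sqmod (braket u v).
Proof. by rewrite /overlap -add_Re2_Im2. Qed.

Lemma overlap_ge0 u v : 0 <= overlap u v.
Proof. by rewrite overlapE sqmod_ge0. Qed.

Lemma overlapC u v : overlap u v = overlap v u.
Proof. by rewrite !overlapE -braket_conj sqmod_conj. Qed.

Lemma bornT u psi : born u psi true = overlap u psi.
Proof.
rewrite /born /projector -mulmxA.
have -> : u^t* *m psi = (braket u psi)%:M.
  by rewrite /braket [LHS]mx11_scalar.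
by rewrite mul_mx_scalar braketZr -(braket_conj u psi) mul_conjE overlapE.
Qed.

Lemma bornF u psi : born u psi false = sqnorm psi - overlap u psi.
Proof.
rewrite -bornT /born /sqnorm mulmxBl mul1mx.
by rewrite braketDr -scaleN1r braketZr mulN1r Re_add Re_opp.
Qed.

Lemma overlapZl a u v : overlap (a *: u) v = sqmod a * overlap u v.
Proof. by rewrite !overlapE braketZl sqmodM sqmod_conj. Qed.

Lemma sqnormZ a u : sqnorm (a *: u) = sqmod a * sqnorm u.
Proof. by rewrite !sqnormE mulr_sumr; apply: eq_bigr => i _; rewrite mxE sqmodM. Qed.

Lemma sqnorm_eq0 u : sqnorm u = 0 -> u = 0.
Proof.
rewrite sqnormE => /eqP; rewrite psumr_eq0 => [/allP u0|i _]; last exact: sqmod_ge0.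
apply/colP => i; rewrite mxE; apply/eqP; rewrite -sqmod_eq0.
exact: (implyP (u0 i (mem_index_enum _))).
Qed.

(** Cauchy-Schwarz. *)
Lemma overlap_le u v : overlap u v <= sqnorm u * sqnorm v.
Proof.
have [u0|u0] := eqVneq (sqnorm u) 0.
  rewrite u0 mul0r (sqnorm_eq0 u0) -(scale0r v) overlapZl.
  by rewrite (sqmod_real 0) expr0n mul0r.
(* This is |u|^2 times the component of [v] orthogonal to [u]; its squared norm is |u|^2 times the
   difference to be shown nonnegative. *)
pose w := (sqnorm u)%:C *: v + (- braket u v) *: u.
have : sqnorm w = sqnorm u * (sqnorm u * sqnorm v - overlap u v).
  rewrite {1}/sqnorm /w !(braketDl, braketDr, braketZl, braketZr).
  rewrite !braket_sqnorm -[braket v u]braket_conj overlapE /sqmod.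
  by case: (braket u v) => a b; rewrite /=; ring.
move: (sqnorm_ge0 w) => /[swap] ->.
by rewrite pmulr_rge0 ?subr_ge0// lt_neqAle eq_sym u0 sqnorm_ge0.
Qed.

Lemma sqnorm_delta (i : 'I_d) : sqnorm (delta_mx i 0) = 1.
Proof.
rewrite sqnormE (bigD1 i)//= big1 => [|j ji].
  by rewrite mxE !eqxx sqmod_real expr1n addr0.
by rewrite mxE (negbTE ji) /= sqmod_real expr0n.
Qed.

Lemma sum_overlap_delta u :
  \sum_i overlap (delta_mx i 0) u = sqnorm u.
Proof.
rewrite sqnormE; apply: eq_bigr => i _; rewrite overlapE braketE.
rewrite (bigD1 i)//= big1 => [|j ji].
  by rewrite mxE !eqxx rmorph1 mul1r addr0.
by rewrite mxE (negbTE ji) rmorph0 mul0r.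
Qed.

End Braket.

(** Gram-Schmidt, applied to the matrix with first row [u^T] and zero rows elsewhere, completes [u]
    to a unitary matrix. The first row changes only by a factor [a], which is nonnegative and of
    modulus 1, hence 1. *)
Lemma unitary_col (R : realType) (d : nat) (u : 'cV[R[i]]_d.+1) :
  sqnorm u = 1 ->
  exists2 h : 'M[R[i]]_d.+1, h \is unitarymx & h *m delta_mx 0 0 = u.
Proof.
move=> u1.
pose A : 'M[R[i]]_d.+1 := \matrix_(i, j) (if i == 0 then u j 0 else 0).
pose B := schmidt A.
have BU : B \is unitarymx by exact: schmidt_unitarymx.
have rA : row 0 A = u^T by apply/rowP => j; rewrite !mxE.
have := form1_row_schmidt A 0; have := row_schmidt_sub A 0.
rewrite (big_pred1 (0 : 'I_d.+1)) => [|k]; last first.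
  by rewrite leqn0.
rewrite genmxE rA -/B => /sub_rVP[a ua].
rewrite ua linearZl_LR /=.
have /row_unitarymxP/(_ 0 0) := BU; rewrite eqxx => B00.
rewrite B00 mulr1 => a0.
have a1 : a = 1.
  have : dotmx u^T u^T = 1.
    transitivity (braket u u); last by rewrite braket_sqnorm u1.
    rewrite dotmxE braketE mxE; apply: eq_bigr => i _.
    by rewrite !mxE mulrC.
  rewrite ua linearZl_LR linearZr_LR /= B00 mulr1 => aa.
  have : `|a| ^+ 2 = 1 by rewrite normCK.
  by rewrite ger0_norm// => /eqP; rewrite sqrp_eq1// => /eqP.
exists B^T; first by rewrite trmx_unitary.
by rewrite -colE -tr_row; apply: trmx_inj; rewrite trmxK ua a1 scale1r.
Qed.

(** A unitary matrix with first column [u] is corrected to determinant 1 by scaling its second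
    column by the conjugate of the determinant. A second column must exist, which is why the
    dimension is written [d.+2]. *)
Lemma SU_transitive (R : realType) (d : nat) (u : 'cV[R[i]]_d.+2) :
  sqnorm u = 1 -> exists2 h : 'M[R[i]]_d.+2, SU h & h *m delta_mx 0 0 = u.
Proof.
move=> /unitary_col[h hU hu].
pose s := \det h.
have s1 : s * s^* = 1.
  by rewrite /s -[X in X^*]det_tr -det_map_mx -det_mulmx (unitarymxP hU) det1.
pose D : 'rV[R[i]]_d.+2 := \row_i (if i == 1 then s^* else 1).
exists (h *m diag_mx D); last first.
  rewrite -mulmxA -hu; congr mulmx; apply/matrixP => i j.
  rewrite mul_diag_mx !mxE ord1 andbT.
  by case: (eqVneq i 0) => [->|_]; rewrite /= ?mulr0 ?mul1r.
split; last first.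
  rewrite det_mulmx det_diag (bigD1 1)//= big1 => [|i i1]; last first.
    by rewrite mxE (negbTE i1).
  by rewrite mxE eqxx mulr1.
apply: (mul_unitarymx hU); apply/unitarymxP.
rewrite tr_diag_mx map_diag_mx mulmx_diag; apply/matrixP => i j.
rewrite !mxE; case: (eqVneq i j) => // _; rewrite mulr1n.
case: ifP => _ /=; last by rewrite rmorph1 mulr1.
by rewrite conjCK mulrC.
Qed.

(** * Measurability *)

Section ComplexMeasurability.
Context (R : realType) (disp : measure_display) (T : measurableType disp).
Implicit Types f g : T -> R[i].

Definition cmeasurable f :=
  measurable_fun setT (fun w => Re (f w)) /\
  measurable_fun setT (fun w => Im (f w)).

Lemma cmeasurable_cst (a : R[i]) : cmeasurable (fun=> a).
Proof. by split; exact: measurable_cst. Qed.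

Lemma cmeasurableD f g :
  cmeasurable f -> cmeasurable g -> cmeasurable (fun w => f w + g w).
Proof.
move=> [f1 f2] [g1 g2]; split.
  by under eq_fun do rewrite Re_add; exact: measurable_funD.
by under eq_fun do rewrite Im_add; exact: measurable_funD.
Qed.

Lemma cmeasurableM f g :
  cmeasurable f -> cmeasurable g -> cmeasurable (fun w => f w * g w).
Proof.
move=> [f1 f2] [g1 g2]; split.
  by under eq_fun do rewrite Re_mul; apply: measurable_funB; exact: measurable_funM.
by under eq_fun do rewrite Im_mul; apply: measurable_funD; exact: measurable_funM.
Qed.

Lemma cmeasurable_conj f : cmeasurable f -> cmeasurable (fun w => (f w)^*).
Proof.
move=> [f1 f2]; split.
  by under eq_fun do rewrite Re_conjc.
by under eq_fun do rewrite Im_conjc; exact: measurableT_comp.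
Qed.

Lemma cmeasurable_sum (I : Type) (r : seq I) (F : I -> T -> R[i]) :
  (forall i, cmeasurable (F i)) -> cmeasurable (fun w => \sum_(i <- r) F i w).
Proof.
move=> mF; elim: r => [|i r IH].
  by under eq_fun do rewrite big_nil; exact: cmeasurable_cst.
by under eq_fun do rewrite big_cons; exact: cmeasurableD.
Qed.

Lemma cmeasurable_prod (I : Type) (r : seq I) (F : I -> T -> R[i]) :
  (forall i, cmeasurable (F i)) -> cmeasurable (fun w => \prod_(i <- r) F i w).
Proof.
move=> mF; elim: r => [|i r IH].
  by under eq_fun do rewrite big_nil; exact: cmeasurable_cst.
by under eq_fun do rewrite big_cons; exact: cmeasurableM.
Qed.

Lemma measurable_sqmod f :
  cmeasurable f -> measurable_fun setT (fun w => sqmod (f w)).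
Proof. by move=> [f1 f2]; apply: measurable_funD; exact: measurable_funX. Qed.

(** Preimages need only be checked on the generating [coordinate_sets]; measurability of matrix
    expressions thus reduces to that of real functions. *)
Lemma measurable_borelMP (m n : nat) (X : T -> borelM R m n) :
  measurable_fun setT X <->
  forall i j, cmeasurable (fun w => (X w : 'M[R[i]]_(m, n)) i j).
Proof.
split=> [mX i j|mX].
  split=> _ B mB; rewrite setTI.
    rewrite -[X in measurable X]setTI; apply: (mX measurableT
      [set A : 'M[R[i]]_(m, n) | B (Re (A i j))]).
    by apply: sub_sigma_algebra; exists i, j, B; split=> //; left.
  rewrite -[X in measurable X]setTI; apply: (mX measurableT
    [set A : 'M[R[i]]_(m, n) | B (Im (A i j))]).
  by apply: sub_sigma_algebra; exists i, j, B; split=> //; right.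
apply: (@measurability _ _ T (borelM R m n) setT X
  (coordinate_sets (R:=R) (m:=m) (n:=n))) => //.
move=> _ [A [i [j [B [mB [->|->]]]]] <-].
- by have [+ _] := mX i j => /(_ measurableT B mB).
- by have [_ +] := mX i j => /(_ measurableT B mB).
Qed.

Lemma cmeasurable_mulmx (m n p : nat) (X : T -> 'M[R[i]]_(m, n))
    (Y : T -> 'M[R[i]]_(n, p)) :
  (forall i j, cmeasurable (fun w => X w i j)) ->
  (forall i j, cmeasurable (fun w => Y w i j)) ->
  forall i j, cmeasurable (fun w => (X w *m Y w) i j).
Proof.
move=> mX mY i j; under eq_fun do rewrite mxE.
by apply: cmeasurable_sum => k; exact: cmeasurableM.
Qed.

Lemma measurable_mulmxl (m n p : nat) (X : T -> borelM R m n) (k : 'M[R[i]]_(n, p)) :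
  measurable_fun setT X ->
  measurable_fun setT (fun w => (X w : 'M[R[i]]_(m, n)) *m k : borelM R m p).
Proof.
move=> /measurable_borelMP mX; apply/measurable_borelMP.
by apply: cmeasurable_mulmx => // i j; exact: cmeasurable_cst.
Qed.

Lemma measurable_mulmxr (m n p : nat) (k : 'M[R[i]]_(m, n)) (X : T -> borelM R n p) :
  measurable_fun setT X ->
  measurable_fun setT (fun w => k *m (X w : 'M[R[i]]_(n, p)) : borelM R m p).
Proof.
move=> /measurable_borelMP mX; apply/measurable_borelMP.
by apply: cmeasurable_mulmx => // i j; exact: cmeasurable_cst.
Qed.

Lemma cmeasurable_braket (d : nat) (X Y : T -> borelM R d 1) :
  measurable_fun setT X -> measurable_fun setT Y ->
  cmeasurable (fun w => braket (X w : 'cV[R[i]]_d) (Y w : 'cV[R[i]]_d)).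
Proof.
move=> /measurable_borelMP mX /measurable_borelMP mY.
under eq_fun do rewrite braketE.
by apply: cmeasurable_sum => i; apply: cmeasurableM => //; exact: cmeasurable_conj.
Qed.

Lemma measurable_overlap (d : nat) (X Y : T -> borelM R d 1) :
  measurable_fun setT X -> measurable_fun setT Y ->
  measurable_fun setT (fun w => overlap (X w : 'cV[R[i]]_d) (Y w : 'cV[R[i]]_d)).
Proof.
move=> mX mY; under eq_fun do rewrite overlapE.
exact/measurable_sqmod/cmeasurable_braket.
Qed.

Lemma measurable_sqnorm (d : nat) (X : T -> borelM R d 1) :
  measurable_fun setT X ->
  measurable_fun setT (fun w => sqnorm (X w : 'cV[R[i]]_d)).
Proof. by move=> mX; have [] := cmeasurable_braket mX mX. Qed.

Lemma measurable_born (d : nat) (X Y : T -> borelM R d 1) (b : bool) :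
  measurable_fun setT X -> measurable_fun setT Y ->
  measurable_fun setT (fun w => born (X w : 'cV[R[i]]_d) (Y w : 'cV[R[i]]_d) b).
Proof.
move=> mX mY; case: b.
  by under eq_fun do rewrite bornT; exact: measurable_overlap.
under eq_fun do rewrite bornF.
by apply: measurable_funB; [exact: measurable_sqnorm|exact: measurable_overlap].
Qed.

End ComplexMeasurability.

Lemma measurable_SU (R : realType) (d : nat) : measurable (@SU R d : set (borelM R d d)).
Proof.
(* A sum of squared moduli that vanishes exactly when all defining equations of SU(d) hold, so SU(d)
   is the zero set of one measurable real function. *)
pose h (g : 'M[R[i]]_d) : R :=
  \sum_i \sum_j sqmod ((g *m g^t*) i j - (1%:M : 'M[R[i]]_d) i j) + sqmod (\det g - 1).
rewrite [X in measurable X](_ : _ = setT `&` (h : borelM R d d -> R) @^-1` [set 0]).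
  apply: (_ : measurable_fun setT (h : borelM R d d -> R)) => //.
  have mid : forall i j, cmeasurable (fun g : borelM R d d => (g : 'M[R[i]]_d) i j).
    by apply/measurable_borelMP; exact: measurable_id.
  have cB (f : borelM R d d -> R[i]) a : cmeasurable f -> cmeasurable (fun w => f w - a).
    by move=> mf; apply: cmeasurableD => //; exact: cmeasurable_cst.
  apply: measurable_funD.
    apply: measurable_sum => i; apply: measurable_sum => j.
    apply/measurable_sqmod/cB; apply: cmeasurable_mulmx => // k l.
    by under eq_fun do rewrite !mxE; exact: cmeasurable_conj.
  apply/measurable_sqmod/cB; rewrite /determinant.
  apply: cmeasurable_sum => s; apply: cmeasurableM; first exact: cmeasurable_cst.
  exact: cmeasurable_prod.
rewrite setTI; apply/seteqP; split=> g; rewrite /SU/= /h.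
  move=> [/unitarymxP -> ->]; rewrite subrr big1 ?add0r => [|i _].
    by apply/eqP; rewrite sqmod_eq0.
  by rewrite big1// => j _; rewrite subrr; apply/eqP; rewrite sqmod_eq0.
move=> /eqP; have h0 i : 0 <= \sum_j sqmod ((g *m g^t*) i j - (1%:M : 'M[R[i]]_d) i j).
  by rewrite sumr_ge0// => j _; exact: sqmod_ge0.
rewrite paddr_eq0 ?sqmod_ge0 ?sumr_ge0// => /andP[].
rewrite psumr_eq0// => /allP gg; rewrite sqmod_eq0 subr_eq0 => /eqP ->; split=> //.
apply/unitarymxP/matrixP => i j.
have := gg i (mem_index_enum _); rewrite psumr_eq0; last by move=> *; exact: sqmod_ge0.
by move=> /allP/(_ j (mem_index_enum _)); rewrite sqmod_eq0 subr_eq0 => /eqP.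
Qed.

(* Needed because the structures of borelM do not unify with the general filter
   instance of the library. *)
#[local] Instance ae_filter_borelM (R : realType) (m n : nat)
  (mu : probability (borelM R m n) R) : Filter (nbhs (almost_everywhere mu)).
Proof. exact: ae_filter_ringOfSetsType. Qed.

(** * Means of almost everywhere bounded functions *)

Section AeBounded.
Context (R : realType) (disp : measure_display) (T : measurableType disp).
Variable mu : probability T R.
Implicit Types f g : T -> R.

(** The measure [mu] lives on all matrices, and overlaps with g|0> have a uniform bound only for g
    in SU(d), hence a bound almost everywhere. On a probability space this gives integrability, and
    the class is closed under products. *)
Definition ae_bounded f :=
  measurable_fun setT f /\ exists C : R, {ae mu, forall w, `|f w| <= C}.

Definition mean f : R := \int[mu]_w f w.

Lemma ae_bounded_cst (a : R) : ae_bounded (fun=> a).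
Proof. by split; [exact: measurable_cst|exists `|a|; exact: nearW]. Qed.

Lemma ae_boundedD f g : ae_bounded f -> ae_bounded g -> ae_bounded (fun w => f w + g w).
Proof.
move=> [mf [a fa]] [mg [b gb]]; split; first exact: measurable_funD.
exists (a + b); move: fa gb; apply: filterS2 => w fa gb.
by rewrite (le_trans (ler_normD _ _))// lerD.
Qed.

Lemma ae_boundedM f g : ae_bounded f -> ae_bounded g -> ae_bounded (fun w => f w * g w).
Proof.
move=> [mf [a fa]] [mg [b gb]]; split; first exact: measurable_funM.
exists (a * b); move: fa gb; apply: filterS2 => w fa gb.
by rewrite normrM ler_pM.
Qed.

Lemma ae_boundedX f n : ae_bounded f -> ae_bounded (fun w => f w ^+ n).
Proof.
move=> bf; elim: n => [|n IH].
  by under eq_fun do rewrite expr0; exact: ae_bounded_cst.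
by under eq_fun do rewrite exprS; exact: ae_boundedM.
Qed.

Lemma ae_boundedB f g : ae_bounded f -> ae_bounded g -> ae_bounded (fun w => f w - g w).
Proof.
move=> bf bg; under eq_fun do rewrite -mulN1r.
by apply: ae_boundedD => //; apply: ae_boundedM => //; exact: ae_bounded_cst.
Qed.

Lemma ae_bounded_sum (I : Type) (r : seq I) (F : I -> T -> R) :
  (forall i, ae_bounded (F i)) -> ae_bounded (fun w => \sum_(i <- r) F i w).
Proof.
move=> bF; elim: r => [|i r IH].
  by under eq_fun do rewrite big_nil; exact: ae_bounded_cst.
by under eq_fun do rewrite big_cons; exact: ae_boundedD.
Qed.

Lemma ae_bounded_indic (A : set T) : measurable A -> ae_bounded \1_A.
Proof.
move=> mA; split; first exact: measurable_indic.
by exists 1; apply: nearW => w; rewrite indicE; case: (_ \in _); rewrite ?normr1 ?normr0.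
Qed.

Lemma ae_bounded_integrable f : ae_bounded f -> mu.-integrable setT (EFin \o f).
Proof.
move=> [mf [C fC]]; apply/integrableP; split; first exact/measurable_EFinP.
apply: (@le_lt_trans _ _ (\int[mu]_w (`|C|)%:E)%E); last first.
  by rewrite integral_cst//= probability_setT mule1 ltry.
apply: ae_ge0_le_integral => //; first by do 2 apply: measurableT_comp => //.
by move: fC; apply: filterS => w fC _; rewrite lee_fin (le_trans fC)// ler_norm.
Qed.

Lemma mean_ext f g : f =1 g -> mean f = mean g.
Proof. by move=> /funext ->. Qed.

Lemma mean_cst (a : R) : mean (fun=> a) = a.
Proof. by rewrite /mean Rintegral_cst//= probability_setT mulr1. Qed.

Lemma meanD f g : ae_bounded f -> ae_bounded g ->
  mean (fun w => f w + g w) = mean f + mean g.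
Proof. by move=> bf bg; apply: RintegralD => //; exact: ae_bounded_integrable. Qed.

Lemma meanB f g : ae_bounded f -> ae_bounded g ->
  mean (fun w => f w - g w) = mean f - mean g.
Proof. by move=> bf bg; apply: RintegralB => //; exact: ae_bounded_integrable. Qed.

Lemma meanZ (a : R) f : ae_bounded f -> mean (fun w => a * f w) = a * mean f.
Proof. by move=> bf; apply: RintegralZl => //; exact: ae_bounded_integrable. Qed.

Lemma mean_sum (I : Type) (r : seq I) (F : I -> T -> R) :
  (forall i, ae_bounded (F i)) ->
  mean (fun w => \sum_(i <- r) F i w) = \sum_(i <- r) mean (F i).
Proof.
move=> bF; elim: r => [|i r IH].
  by under mean_ext do rewrite big_nil; rewrite mean_cst big_nil.
under mean_ext do rewrite big_cons.
by rewrite meanD//; [rewrite IH big_cons|exact: ae_bounded_sum].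
Qed.

Lemma mean_ae_eq f g : measurable_fun setT f -> measurable_fun setT g ->
  {ae mu, forall w, f w = g w} -> mean f = mean g.
Proof.
move=> mf mg fg; congr fine; apply: ae_eq_integral => //.
- exact/measurable_EFinP.
- exact/measurable_EFinP.
- by move: fg; apply: filterS => w -> _.
Qed.

Lemma mean_integral f : ae_bounded f -> (\int[mu]_w (f w)%:E = (mean f)%:E)%E.
Proof.
by move=> bf; rewrite fineK//; exact/integrable_fin_num/ae_bounded_integrable.
Qed.

End AeBounded.

(** * Powers of quadratic polynomials *)

Section QuadraticPower.
Variable K : comNzRingType.
Implicit Types (x y z t : K).

Definition quad x y z : {poly K} := x%:P + y *: 'X + z *: 'X^2.

Lemma quadE x y z t : (quad x y z).[t] = x + t * y + t ^+ 2 * z.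
Proof. by rewrite /quad !hornerE /=; ring. Qed.

Lemma coef_quad x y z i : (quad x y z)`_i = [:: x; y; z]`_i.
Proof.
rewrite /quad !coefE; case: i => [|[|[|i]]] /=;
  rewrite ?mulr0 ?mulr1 ?addr0 ?add0r// nth_nil//.
Qed.

Lemma coef0_quadX x y z n : (quad x y z ^+ n)`_0 = x ^+ n.
Proof.
elim: n => [|n IH]; first by rewrite !expr0 coef1.
by rewrite !exprS coefM big_ord_recl big_ord0 addr0 /= IH coef_quad.
Qed.

Lemma coef1_quadX x y z n : (quad x y z ^+ n)`_1 = n%:R * x ^+ n.-1 * y.
Proof.
elim: n => [|n IH]; first by rewrite !expr0 coef1 /= !mul0r.
rewrite exprS coefM !big_ord_recl big_ord0 addr0 /= IH coef0_quadX !coef_quad /=.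
case: n {IH} => [|n] /=; first by rewrite !expr0; ring.
by rewrite exprS -[n.+2%:R]natr1; ring.
Qed.

(** Doubling avoids dividing n(n+1) by 2 in a general commutative ring. At n = 0 the truncated
    exponent [n.-1] is harmless because of the factor n. *)
Lemma coef2_quadX x y z n : (quad x y z ^+ n.+1)`_2 *+ 2 =
  (n.+1%:R * x ^+ n * z) *+ 2 + n.+1%:R * n%:R * x ^+ n.-1 * y ^+ 2.
Proof.
elim: n => [|n IH].
  by rewrite expr1 coef_quad /= expr0; ring.
rewrite exprS coefM !big_ord_recl big_ord0 addr0 /= !mulrnDl -!mulrnAr IH.
rewrite coef0_quadX coef1_quadX !coef_quad /=.
case: n {IH} => [|n] /=; first by rewrite !expr0; ring.
by rewrite !exprS -[n.+3%:R]natr1 -[n.+2%:R]natr1; ring.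
Qed.

Lemma size_quadX x y z n : (size (quad x y z ^+ n) <= (2 * n).+1)%N.
Proof.
have s2 : (size (quad x y z) <= 3)%N.
  apply/leq_sizeP => -[|[|[|j]]]// _.
  by rewrite coef_quad /= nth_nil.
apply: (leq_trans (size_poly_exp_leq _ _)).
rewrite ltnS leq_mul2r orbC; move: s2; case: (size _) => // -[|[|[]]]//.
Qed.

End QuadraticPower.

(** Otherwise [p - q] would have as roots at least as many distinct naturals as its size. *)
Lemma poly_ext_nat (K : numFieldType) (p q : {poly K}) :
  (forall t, p.[t] = q.[t]) -> p = q.
Proof.
move=> pq; apply/eqP; rewrite -subr_eq0; apply/eqP.
apply: (@roots_geq_poly_eq0 _ _ [seq i%:R | i <- iota 0 (size (p - q))]).
- by apply/allP => t _; rewrite rootE hornerD hornerN pq subrr.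
- rewrite map_inj_uniq ?iota_uniq// => i j /eqP.
  by rewrite eqr_nat => /eqP.
- by rewrite size_map size_iota.
Qed.

Section QuadraticMean.
Context (R : realType) (disp : measure_display) (T : measurableType disp).
Variable mu : probability T R.
Variables (X Y Z : T -> R).
Hypotheses (bX : ae_bounded mu X) (bY : ae_bounded mu Y) (bZ : ae_bounded mu Z).

Lemma ae_bounded_coef_quadX n i : ae_bounded mu (fun w => (quad (X w) (Y w) (Z w) ^+ n)`_i).
Proof.
have b0 : ae_bounded mu (fun=> 0) by exact: ae_bounded_cst.
have bq j : ae_bounded mu (fun w => (quad (X w) (Y w) (Z w))`_j).
  under eq_fun do rewrite coef_quad.
  by case: j => [|[|[|j]]] //=; under eq_fun do rewrite nth_nil.
elim: n i => [|n IH] i.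
  by under eq_fun do rewrite expr0; exact: ae_bounded_cst.
under eq_fun do rewrite exprS coefM.
by apply: ae_bounded_sum => j; exact: ae_boundedM.
Qed.

(** By linearity the mean of the n-th power is a polynomial in t whose coefficients are means of
    coefficients; an identity valid for every real t can then be read coefficientwise. *)
Lemma mean_coef_quadX (m a b c : R) n :
  (forall t, mean mu (fun w => (X w + t * Y w + t ^+ 2 * Z w) ^+ n) =
             m * (a + t * b + t ^+ 2 * c) ^+ n) ->
  forall i, mean mu (fun w => (quad (X w) (Y w) (Z w) ^+ n)`_i) =
            m * (quad a b c ^+ n)`_i.
Proof.
move=> H i.
pose Q := \poly_(j < (2 * n).+1) mean mu (fun w => (quad (X w) (Y w) (Z w) ^+ n)`_j).
have QE : Q = m *: quad a b c ^+ n.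
  apply: poly_ext_nat => t.
  rewrite hornerZ horner_exp quadE -H horner_poly.
  under mean_ext => w.
    rewrite -quadE -horner_exp (horner_coef_wide _ (size_quadX _ _ _ _)).
    under eq_bigr do rewrite mulrC.
    over.
  rewrite mean_sum => [|j]; last first.
    by apply: ae_boundedM; [exact: ae_bounded_cst|exact: ae_bounded_coef_quadX].
  apply: eq_bigr => j _; rewrite meanZ; last exact: ae_bounded_coef_quadX.
  by rewrite mulrC.
(* Beyond degree 2n both coefficients vanish. *)
have [ilt|ige] := ltnP i (2 * n).+1.
  by rewrite -coefZ -QE coef_poly ilt.
have cq x y z : (quad x y z ^+ n)`_i = 0 :> R.
  by rewrite nth_default// (leq_trans (size_quadX _ _ _ _)).
by under mean_ext do rewrite cq; rewrite mean_cst cq mulr0.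
Qed.

End QuadraticMean.

(** * Haar moments *)

(* The moments m_n = E|<u|phi>|^(2n) of a Haar-random phi do not depend on the
   unit vector u.  The Beta moments E q^k (1-q)^l follow by differences. *)
Fixpoint beta_moment (R : pzRingType) (m : nat -> R) (k l : nat) : R :=
  if l is l'.+1 then beta_moment m k l' - beta_moment m k.+1 l' else m k.

(** In Beta terms, the mean of Beta(k+1, l+d-1) is (k+1)/(k+l+d). Only the recurrence of [m] is
    used: each increase of l replaces moments by differences, and the recurrence passes to these. *)
Lemma beta_momentS (R : realFieldType) (m : nat -> R) (d : nat) :
  (0 < d)%N -> (forall n, (n + d)%:R * m n.+1 = n.+1%:R * m n) ->
  forall k l, (k + l + d)%:R * beta_moment m k.+1 l = k.+1%:R * beta_moment m k l.
Proof.
move=> d0 mS k l; elim: l k => [|l IH] k; first by rewrite addn0 mS.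
rewrite [beta_moment m k.+1 _]/= [beta_moment m k _]/= !mulrBr -IH.
have := IH k.+1; rewrite addSn addnS -!addSn => ->.
by rewrite -!natr1 !natrD -?natr1; ring.
Qed.

(** By [beta_momentS], multiplying the difference that defines the moment at l+1 by k+l+d leaves the
    factor (k+l+d) - (k+1) = l+d-1, which is positive for d >= 2. *)
Lemma beta_moment_gt0 (R : realFieldType) (m : nat -> R) (d : nat) :
  (1 < d)%N -> (forall n, (n + d)%:R * m n.+1 = n.+1%:R * m n) -> 0 < m 0 ->
  forall k l, 0 < beta_moment m k l.
Proof.
move=> d1 mS m0 k l; have d0 : (0 < d)%N by exact: ltnW.
elim: l k => [|l IH] k /=.
  elim: k => [//|k IH].
  have : 0 < (k + d)%:R * m k.+1 by rewrite mS mulr_gt0// ltr0n.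
  by rewrite pmulr_rgt0// ltr0n addn_gt0 d0 orbT.
have D0 : 0 < (k + l + d)%:R :> R by rewrite ltr0n addn_gt0 d0 orbT.
rewrite -(pmulr_rgt0 _ D0) mulrBr beta_momentS// -mulrBl mulr_gt0//.
by rewrite subr_gt0 ltr_nat -addnA -addn1 ltn_add2l ltn_addl.
Qed.

Section HaarMoments.
Context (R : realType) (d : nat).
Variable mu : probability (borelM R d.+2 d.+2) R.
Hypothesis haar : is_haar mu.
Variable k : 'cV[R[i]]_d.+2.
Hypothesis k1 : sqnorm k = 1.

Local Notation orbit g := ((g : 'M[R[i]]_d.+2) *m k).

Implicit Types (u v psi : 'cV[R[i]]_d.+2) (g h : 'M[R[i]]_d.+2).

Lemma ae_SU : {ae mu, forall g, SU (g : 'M[R[i]]_d.+2)}.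
Proof.
exists (~` (@SU R d.+2 : set (borelM R d.+2 d.+2))); split => //.
  by apply: measurableC; exact: measurable_SU.
by rewrite probability_setC; [rewrite (proj1 haar) subee|exact: measurable_SU].
Qed.

Lemma measurable_orbit : measurable_fun setT (fun g : borelM R d.+2 d.+2 =>
  (g : 'M[R[i]]_d.+2) *m k : borelM R d.+2 1).
Proof. exact/measurable_mulmxl/measurable_id. Qed.

Lemma sqnorm_orbit g : SU g -> sqnorm (g *m k) = 1.
Proof. by move=> [gU _]; rewrite /sqnorm braket_unitary. Qed.

Lemma ae_sqnorm_orbit : {ae mu, forall g, sqnorm (orbit g) = 1}.
Proof. by move: ae_SU; apply: filterS => g /sqnorm_orbit. Qed.

(** Left invariance on sets says that the pushforward of [mu] under translation by [h] is [mu]; the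
    change of variables formula for nonnegative functions does the rest. *)
Lemma mean_invariant (f : 'M[R[i]]_d.+2 -> R) h :
  measurable_fun setT (f : borelM R d.+2 d.+2 -> R) -> (forall g, 0 <= f g) ->
  SU h -> mean mu (fun g => f (h *m g)) = mean mu f.
Proof.
move=> mf f0 hSU; congr fine.
have mh : measurable_fun setT (fun g : borelM R d.+2 d.+2 =>
    h *m (g : 'M[R[i]]_d.+2) : borelM R d.+2 d.+2).
  exact/measurable_mulmxr/measurable_id.
transitivity (\int[pushforward mu (fun g : borelM R d.+2 d.+2 =>
    h *m (g : 'M[R[i]]_d.+2) : borelM R d.+2 d.+2)]_g (f g)%:E)%E.
  rewrite ge0_integral_pushforward//; first exact/measurable_EFinP.
  by move=> g _; rewrite lee_fin.
apply: eq_measure_integral => A mA _.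
exact: (proj2 haar h A hSU mA).
Qed.

Lemma ae_bounded_overlap_orbit u :
  ae_bounded mu (fun g => overlap u (orbit g)).
Proof.
split.
  by apply: measurable_overlap; [exact: measurable_cst|exact: measurable_orbit].
exists (sqnorm u); move: ae_sqnorm_orbit; apply: filterS => g g1.
by rewrite ger0_norm ?overlap_ge0// (le_trans (overlap_le _ _))// g1 mulr1.
Qed.

Definition haar_moment n : R :=
  mean mu (fun g => overlap (delta_mx 0 0) (orbit g) ^+ n).

Lemma haar_moment0 : haar_moment 0 = 1.
Proof. by rewrite /haar_moment; under mean_ext do rewrite expr0; rewrite mean_cst. Qed.

Lemma SU_adj h : SU h -> SU (h^t*).
Proof.
move=> [hU hd]; split; first by rewrite trmxC_unitary.
by rewrite det_map_mx det_tr hd rmorph1.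
Qed.

(** Write [u] as h e_0 with h in SU(d), move h to the other side of the braket as its adjoint, and
    absorb it by left invariance. *)
Lemma mean_overlap_unit u n : sqnorm u = 1 ->
  mean mu (fun g => overlap u (orbit g) ^+ n) = haar_moment n.
Proof.
move=> /SU_transitive[h hSU <-].
pose f g : R := overlap (delta_mx 0 0) (g *m k) ^+ n.
transitivity (mean mu (fun g => f (h^t* *m g))).
  apply: mean_ext => g; rewrite /f -mulmxA !overlapE (braket_adj (h^t*)).
  by rewrite map_trmx trmxK map_mxCK.
apply: mean_invariant; last exact: SU_adj.
  apply/measurable_funX/measurable_overlap; first exact: measurable_cst.
  exact: measurable_orbit.
by move=> g; rewrite exprn_ge0// overlap_ge0.
Qed.

(* Both sides are homogeneous in y. *)
Lemma mean_overlap_pow (y : 'cV[R[i]]_d.+2) n :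
  mean mu (fun g => overlap y (orbit g) ^+ n) =
  haar_moment n * sqnorm y ^+ n.
Proof.
have [y0|y0] := eqVneq (sqnorm y) 0.
  rewrite y0 (sqnorm_eq0 y0) expr0n.
  have o0 v : overlap 0 v = 0 by rewrite -(scale0r v) overlapZl sqmod_real expr0n mul0r.
  under mean_ext do rewrite o0 expr0n.
  rewrite mean_cst; case: n => [|n]; last by rewrite mulr0.
  by rewrite haar_moment0 mul1r.
have yp : 0 < sqnorm y by rewrite lt_neqAle eq_sym y0 sqnorm_ge0.
pose r := Num.sqrt (sqnorm y).
have r0 : r != 0 by rewrite gt_eqF// sqrtr_gt0.
have r2 : r ^+ 2 = sqnorm y by rewrite sqr_sqrtr// ltW.
pose u := (r^-1)%:C *: y.
have u1 : sqnorm u = 1 by rewrite sqnormZ sqmod_real exprVn r2 mulVf.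
have -> : y = r%:C *: u.
  by rewrite scalerA -(rmorphM (real_complex R)) /= divff// scale1r.
under mean_ext do rewrite overlapZl exprMn.
rewrite meanZ; last exact/ae_boundedX/ae_bounded_overlap_orbit.
by rewrite mean_overlap_unit// sqnormZ u1 mulr1 mulrC.
Qed.

(** The coefficient of t in |<u + t psi|v>|^2. *)
Definition cross u psi v : R :=
  Re (braket u v * (braket psi v)^*) *+ 2.

Lemma overlap_line u psi v t : overlap (u + t%:C *: psi) v =
  overlap u v + t * cross u psi v + t ^+ 2 * overlap psi v.
Proof.
rewrite !overlapE braketDl braketZl /cross /sqmod.
by case: (braket u v) => a b; case: (braket psi v) => c e /=; ring.
Qed.

Lemma sqnorm_line u psi t : sqnorm (u + t%:C *: psi) =
  sqnorm u + t * (Re (braket u psi) *+ 2) + t ^+ 2 * sqnorm psi.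
Proof.
rewrite /sqnorm !(braketDl, braketDr, braketZl, braketZr) -(braket_conj u psi).
by rewrite !braket_sqnorm; case: (braket u psi) => a b /=; ring.
Qed.

Lemma ae_bounded_cross u psi :
  ae_bounded mu (fun g => cross u psi (orbit g)).
Proof.
(* Taking t = 1 in [overlap_line] writes the cross term through three overlaps, which are already
   known to be bounded. *)
have -> : (fun g : borelM R d.+2 d.+2 => cross u psi (orbit g)) =
  (fun g : borelM R d.+2 d.+2 => overlap (u + 1%:C *: psi) (orbit g) -
     overlap u (orbit g) - overlap psi (orbit g)).
  apply/funext => g; rewrite overlap_line.
  by move: (overlap u _) (cross _ _ _) (overlap psi _) => a b c; ring.
by apply: ae_boundedB; [apply: ae_boundedB|]; exact: ae_bounded_overlap_orbit.
Qed.

(** Twice the coefficient of t^2 in [mean_overlap_pow] for the vector u + t psi and the exponent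
    n+1. *)
Lemma mean_second_order u psi n :
  mean mu (fun g => let v := orbit g in
    (n.+1%:R * overlap u v ^+ n * overlap psi v) *+ 2 +
      n.+1%:R * n%:R * overlap u v ^+ n.-1 * cross u psi v ^+ 2) =
  haar_moment n.+1 * ((n.+1%:R * sqnorm u ^+ n * sqnorm psi) *+ 2 +
    n.+1%:R * n%:R * sqnorm u ^+ n.-1 * (Re (braket u psi) *+ 2) ^+ 2).
Proof.
rewrite -coef2_quadX [RHS]mulrnAr -(@mean_coef_quadX _ _ _ mu
  (fun g => overlap u (orbit g))
  (fun g => cross u psi (orbit g))
  (fun g => overlap psi (orbit g))); first last.
- by move=> t; under mean_ext do rewrite -overlap_line; rewrite mean_overlap_pow sqnorm_line.
- exact: ae_bounded_overlap_orbit.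
- exact: ae_bounded_cross.
- exact: ae_bounded_overlap_orbit.
under mean_ext do rewrite /= -coef2_quadX -mulr_natl.
rewrite meanZ ?mulr_natl//.
by apply: ae_bounded_coef_quadX; [exact: ae_bounded_overlap_orbit|
  exact: ae_bounded_cross|exact: ae_bounded_overlap_orbit].
Qed.

(* The t^2-coefficients for psi and 'i psi add up: the squared cross terms are
   the squared real and imaginary parts of 2<u|phi><phi|psi>. *)
Lemma mean_overlapXM u psi n : sqnorm u = 1 ->
  n.+1%:R * mean mu (fun g => overlap u (orbit g) ^+ n *
                              overlap psi (orbit g)) =
  haar_moment n.+1 * (sqnorm psi + n%:R * overlap u psi).
Proof.
move=> u1.
pose ip : 'cV[R[i]]_d.+2 := (Complex 0 1) *: psi.
have ipo v : overlap ip v = overlap psi v.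
  by rewrite overlapZl /sqmod /= expr0n expr1n add0r mul1r.
have ips : sqnorm ip = sqnorm psi.
  by rewrite sqnormZ /sqmod /= expr0n expr1n add0r mul1r.
have crossE v : cross u psi v ^+ 2 + cross u ip v ^+ 2 = 4 * (overlap u v * overlap psi v).
  rewrite /cross /ip braketZl !overlapE /sqmod.
  by case: (braket u v) => a b; case: (braket psi v) => c e /=; ring.
have ReE : (Re (braket u psi) *+ 2) ^+ 2 + (Re (braket u ip) *+ 2) ^+ 2 = 4 * overlap u psi.
  by rewrite /ip braketZr overlapE /sqmod; case: (braket u psi) => a b /=; ring.
have bO v := ae_bounded_overlap_orbit v.
have bS psi' : ae_bounded mu (fun g => let v := orbit g in
    (n.+1%:R * overlap u v ^+ n * overlap psi' v) *+ 2 +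
      n.+1%:R * n%:R * overlap u v ^+ n.-1 * cross u psi' v ^+ 2).
  have bX m := ae_boundedX m (bO u).
  apply: ae_boundedD; last first.
    apply: ae_boundedM; last exact/ae_boundedX/ae_bounded_cross.
    by apply: ae_boundedM; [exact: ae_bounded_cst|].
  under eq_fun do rewrite -mulr_natl.
  apply: ae_boundedM; first exact: ae_bounded_cst.
  by apply: ae_boundedM => //; apply: ae_boundedM => //; exact: ae_bounded_cst.
have := congr2 +%R (mean_second_order u psi n) (mean_second_order u ip n).
rewrite -meanD// -mulrDr u1 !expr1n !mulr1 ips.
set lhs := mean mu _.
(* The two doubled main terms contribute 4(n+1) and the squared cross terms 4n(n+1), in total
   4(n+1)^2. One factor 4(n+1) is kept apart because it cancels against the right-hand side. *)
have -> : lhs = 4 * n.+1%:R * (n.+1%:R * mean mu (fun g =>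
    overlap u (orbit g) ^+ n * overlap psi (orbit g))).
  rewrite mulrA -meanZ; last by apply: ae_boundedM => //; exact: ae_boundedX.
  apply: mean_ext => g /=; rewrite ipo.
  move: (crossE (g *m k)).
  move: (overlap u _) (overlap psi _) (cross u psi _) (cross u ip _) => a b c e ce.
  rewrite addrACA -mulrDr ce; case: (n) => [|m] /=; first by ring.
  by rewrite exprS -[m.+2%:R]natr1; ring.
rewrite addrACA -mulrDr ReE => eq_lhs.
have n4 : 4 * n.+1%:R != 0 :> R by rewrite mulf_neq0 ?pnatr_eq0.
apply: (mulfI n4); rewrite eq_lhs.
by move: (haar_moment _) (sqnorm psi) (overlap u psi) => a b c; ring.
Qed.

Lemma haar_momentS n : (n + d.+2)%:R * haar_moment n.+1 = n.+1%:R * haar_moment n.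
Proof.
pose u : 'cV[R[i]]_d.+2 := delta_mx 0 0.
have sd (j : 'I_d.+2) := sqnorm_delta R j.
have /(congr1 (fun f => \sum_i f i)) : (fun i : 'I_d.+2 => n.+1%:R *
  mean mu (fun g => overlap u (orbit g) ^+ n *
                    overlap (delta_mx i 0) (orbit g))) =
   (fun i => haar_moment n.+1 * (1 + n%:R * overlap (delta_mx i 0) u)).
  by apply/funext => i; rewrite (mean_overlapXM _ _ (sd 0)) sd (overlapC u).
rewrite -!mulr_sumr big_split /= -mulr_sumr sum_overlap_delta sd.
rewrite sumr_const card_ord mulr1 -natrD addnC => H.
rewrite [LHS]mulrC -H.
congr (_ * _); rewrite -mean_sum; last first.
  by move=> i; apply: ae_boundedM; [apply: ae_boundedX|];
    exact: ae_bounded_overlap_orbit.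
(* The sum over the basis is |phi|^2, known to be 1 only for g in SU(d), hence a comparison almost
   everywhere. *)
apply: mean_ae_eq.
- apply: measurable_sum => i; apply: measurable_funM; [apply: measurable_funX|];
    exact: (proj1 (ae_bounded_overlap_orbit _)).
- by apply: measurable_funX; exact: (proj1 (ae_bounded_overlap_orbit _)).
move: ae_sqnorm_orbit; apply: filterS => g g1.
by rewrite -mulr_sumr sum_overlap_delta g1 mulr1.
Qed.

Lemma mean_overlap_beta u : sqnorm u = 1 -> forall m l,
  mean mu (fun g => overlap u (orbit g) ^+ m *
                    (1 - overlap u (orbit g)) ^+ l) =
  beta_moment haar_moment m l.
Proof.
move=> u1 m l; have bO := ae_bounded_overlap_orbit u.
elim: l m => [|l IH] m /=.
  by under mean_ext do rewrite expr0 mulr1; exact: mean_overlap_unit.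
have bml m' : ae_bounded mu (fun g => overlap u (orbit g) ^+ m' *
                    (1 - overlap u (orbit g)) ^+ l).
  apply: ae_boundedM; apply: ae_boundedX => //.
  by apply: ae_boundedB => //; exact: ae_bounded_cst.
rewrite -!IH -meanB//; apply: mean_ext => g.
by rewrite !exprS; ring.
Qed.

(** Normalization of the covariant measurement: the moment m_n is the inverse of the prefactor in
    [covariant_density]. Below it is used with the estimate fixed and phi averaged. *)
Lemma binomial_haar_moment n : 'C(n + d.+2 - 1, d.+2 - 1)%:R * haar_moment n = 1.
Proof.
rewrite addnS !subn1 /=; elim: n => [|n IH].
  by rewrite binn haar_moment0 mulr1.
have n0 : (n + d.+2)%:R != 0 :> R by rewrite pnatr_eq0 addnS.
apply: (mulfI n0); rewrite mulr1 mulrCA haar_momentS mulrA -natrM.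
have -> : ('C(n.+1 + d.+1, d.+1) * n.+1 = (n + d.+2) * 'C(n + d.+1, d.+1))%N.
  have := mul_bin_down (n.+1 + d.+1) d.+1.
  by rewrite addnK addSn /= [(n + d.+2)%N]addnS => ->; rewrite mulnC.
by rewrite natrM -mulrA IH mulr1.
Qed.

End HaarMoments.

(** * Joint law of states and outcomes *)

Section WeightedIntegral.
Local Open Scope ereal_scope.
Context (R : realType) (disp disp' : measure_display).
Context (T : measurableType disp) (E : measurableType disp').
Variables (P : {measure set T -> \bar R}) (X : T -> E).
Hypothesis mX : measurable_fun setT X.

Import HBNNSimple.

Lemma nnsfun_weighted_integral (f : {nnsfun E >-> R}) (h : T -> \bar R) :
  measurable_fun setT h -> (forall w, 0 <= h w) ->
  \int[P]_w ((f (X w))%:E * h w) =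
  \sum_(r \in range f) r%:E * \int[P]_w ((\1_(f @^-1` [set r]) (X w))%:E * h w).
Proof.
move=> mh h0.
have mI r : measurable_fun setT (fun w => (\1_(f @^-1` [set r]) (X w))%:E * h w).
  apply: emeasurable_funM => //; apply/measurable_EFinP.
  by apply: measurableT_comp => //; exact: measurable_indic.
have E1 w : (f (X w))%:E * h w =
    \sum_(r \in range f) (r%:E * ((\1_(f @^-1` [set r]) (X w))%:E * h w)).
  rewrite fimfunE -fsumEFin// ge0_mule_fsuml.
    by apply: eq_fsbigr => r _; rewrite EFinM muleA.
  by move=> r; rewrite EFinM nnfun_muleindic_ge0.
under eq_integral do rewrite E1.
rewrite ge0_integral_fsum//; last 2 first.
- by move=> r; exact: measurable_funeM.
- by move=> r w _; rewrite muleA mule_ge0// nnfun_muleindic_ge0.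
apply: eq_fsbigr => r; rewrite inE => -[/= t _ <-{r}].
by rewrite ge0_integralZl// => [w _|]; rewrite ?mule_ge0// lee_fin.
Qed.

(** Passes from indicators to nonnegative functions, through simple functions and monotone
    convergence. It is needed because [ep_outcomes] speaks of sets only. *)
Lemma eq_weighted_integral (h1 h2 : T -> \bar R) (f : E -> R) :
  measurable_fun setT h1 -> (forall w, 0 <= h1 w) ->
  measurable_fun setT h2 -> (forall w, 0 <= h2 w) ->
  (forall A, measurable A -> \int[P]_w ((\1_A (X w))%:E * h1 w) =
                             \int[P]_w ((\1_A (X w))%:E * h2 w)) ->
  measurable_fun setT f -> (forall y, (0 <= f y)%R) ->
  \int[P]_w ((f (X w))%:E * h1 w) = \int[P]_w ((f (X w))%:E * h2 w).
Proof.
move=> mh1 h10 mh2 h20 H mf f0.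
have mf' : measurable_fun setT (EFin \o f) by exact/measurable_EFinP.
pose f_ := nnsfun_approx measurableT mf'.
have step (h : T -> \bar R) : measurable_fun setT h -> (forall w, 0 <= h w) ->
    \int[P]_w ((f (X w))%:E * h w) =
    limn (fun n => \int[P]_w ((f_ n (X w))%:E * h w)).
  move=> mh h0; rewrite -monotone_convergence//; last 3 first.
  - move=> n; apply: emeasurable_funM => //.
    by apply/measurable_EFinP; exact: measurableT_comp.
  - by move=> n w _; rewrite mule_ge0// lee_fin.
  - move=> w _ m n mn; rewrite lee_wpmul2r// lee_fin.
    exact/lefP/nd_nnsfun_approx.
  apply: eq_integral => w _; apply/esym/cvg_lim => //.
  have fc : (fun n => (f_ n (X w))%:E) @ \oo --> (f (X w))%:E.
    by apply: cvg_nnsfun_approx => // y _; rewrite lee_fin.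
  (* [h w] may be infinite, so a zero value of f is treated apart to avoid the indeterminate limit
     of 0 times infinity: there the approximations, lying below f, are zero too. *)
  have [fX0|fX0] := eqVneq (f (X w)) 0%R.
    rewrite fX0 mul0e; apply: cvg_near_cst; apply: nearW => n.
    rewrite (_ : f_ n (X w) = 0%R) ?mul0e//; apply/eqP; rewrite eq_le.
    apply/andP; split; last exact: fun_ge0.
    rewrite -fX0 -lee_fin nnsfun_approxE.
    by apply: (le_approx (f := EFin \o f)) => // y _; rewrite lee_fin.
  apply: cvgeM => //; last exact: cvg_cst.
  have [hf|hf] := boolP (h w \is a fin_num); first exact: mule_def_fin.
  exact: mule_def_neq0_infty.
rewrite !step//; congr (limn _); apply/funext => n.
rewrite !nnsfun_weighted_integral//; apply: eq_fsbigr => r _.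
by rewrite H.
Qed.

End WeightedIntegral.

(** * Outcome probabilities and conditional means of the overlap *)

Section Outcomes.
Context (R : realType) (d N M : nat).
Variable mu : probability (borelM R d.+2 d.+2) R.
Variable ket0 : 'cV[R[i]]_d.+2.
Context (disp : measure_display) (T : measurableType disp).
Variable P : probability T R.
Variables (psi phi : {RV P >-> borelM R d.+2 1}) (V : {RV P >-> borelM R d.+2 d.+2}).
Variable x : 'I_N -> {RV P >-> bool}.
Hypothesis H : estimate_and_project M mu ket0 psi phi V x.

Local Notation G := (borelM R d.+2 d.+2).
Local Notation E := (borelM R d.+2 1).
Local Notation orbit g := ((g : 'M[R[i]]_d.+2) *m ket0).

Let haar := ep_haar H.

Lemma sqnorm_ket0 : sqnorm ket0 = 1.
Proof. by rewrite /sqnorm (ep_ket0 H). Qed.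

Let measurable_unit : measurable [set v : E | sqnorm (v : 'cV[R[i]]_d.+2) = 1].
Proof.
rewrite -[X in measurable X]setTI.
have mn : measurable_fun setT (fun v : E => sqnorm (v : 'cV[R[i]]_d.+2)).
  exact/measurable_sqnorm/measurable_id.
exact: (mn measurableT [set 1] (measurable_set1 1)).
Qed.

Lemma ae_unit_law (Y : {RV P >-> E}) :
  (forall A : set E, measurable A ->
    P (Y @^-1` A) = mu [set g : 'M[R[i]]_d.+2 | A (g *m ket0)]) ->
  {ae P, forall w, sqnorm (Y w : 'cV[R[i]]_d.+2) = 1}.
Proof.
move=> lawY; pose A : set E := ~` [set v : E | sqnorm (v : 'cV[R[i]]_d.+2) = 1].
have mA : measurable A by exact: measurableC.
exists (Y @^-1` A); split => //.
  by rewrite -[X in measurable X]setTI; exact: measurable_funPT.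
have mB : measurable [set g : G | A (orbit g)].
  by rewrite -[X in measurable X]setTI; exact: (measurable_orbit ket0).
rewrite lawY//; apply/eqP; rewrite -measure_le0.
have /negligibleP <- // : mu.-negligible [set g : G | A (orbit g)].
exact: (ae_sqnorm_orbit haar sqnorm_ket0).
Qed.

Lemma ae_psi : {ae P, forall w, sqnorm (psi w : 'cV[R[i]]_d.+2) = 1}.
Proof. exact/ae_unit_law/(ep_psi H). Qed.

Lemma ae_phi : {ae P, forall w, sqnorm (phi w : 'cV[R[i]]_d.+2) = 1}.
Proof. exact/ae_unit_law/(ep_phi H). Qed.

Local Open Scope ereal_scope.

Lemma integral_law (Y : {RV P >-> E}) (f : E -> \bar R) :
  (forall A : set E, measurable A ->
    P (Y @^-1` A) = mu [set g : 'M[R[i]]_d.+2 | A (g *m ket0)]) ->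
  measurable_fun setT f -> (forall v, 0 <= f v) ->
  \int[distribution P Y]_v f v = \int[mu]_g f (orbit g).
Proof.
move=> lawY mf f0.
have mo := @measurable_orbit R d ket0.
transitivity (\int[pushforward mu (fun g : G => orbit g : E)]_v f v).
  by apply: eq_measure_integral => A mA _; exact: lawY.
by rewrite ge0_integral_pushforward.
Qed.

(** By independence and uniqueness of product measures, the joint law of the states is the product
    of their laws. Tonelli then splits the integral, and each law is pulled back to the group. *)
Lemma integral_states (F : E * E -> \bar R) :
  measurable_fun setT F -> (forall z, 0 <= F z) ->
  \int[P]_w F (psi w, phi w) =
  \int[mu]_g1 \int[mu]_g2 F (orbit g1, orbit g2).
Proof.
move=> mF F0.
have mpp : measurable_fun setT (fun w => (psi w, phi w)).
  by apply/measurable_fun_pair; exact: measurable_funPT.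
transitivity (\int[pushforward P (fun w => (psi w, phi w))]_z F z).
  by rewrite ge0_integral_pushforward.
transitivity (\int[distribution P psi \x distribution P phi]_z F z).
  apply: eq_measure_integral => A mA _.
  apply/esym/(@product_measure_unique _ _ _ _ _ (distribution P psi)
    (distribution P phi) (pushforward P (fun w => (psi w, phi w)))) => //.
  by move=> B C mB mC; exact: (ep_independent H).
rewrite fubini_tonelli1// (integral_law (ep_psi H)).
- apply: eq_integral => g _; rewrite /fubini_F (integral_law (ep_phi H))//.
  exact: measurable_fun_pair2.
- exact: measurable_fun_fubini_tonelli_F.
- by move=> v; apply: integral_ge0.
Qed.

(** Events are indexed by the set of successful projections rather than by its size, since
    [ep_outcomes] gives the law of complete outcome strings. *)
Definition outcome (B : {set 'I_N}) : set T := [set w | forall i, x i w = (i \in B)].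

Definition joint_density (B : {set 'I_N}) (p f u : 'cV[R[i]]_d.+2) : R :=
  (covariant_density M f u * \prod_(i < N) born u p (i \in B))%R.

Lemma measurable_outcome B : measurable (outcome B).
Proof.
have -> : outcome B = \bigcap_(i in [set: 'I_N]) (x i @^-1` [set i \in B]).
  by apply/seteqP; split => [w xB i _|w xB i]; apply: xB.
apply: fin_bigcap_measurable => // i _.
by rewrite -[X in measurable X]setTI; exact: (measurable_funPT (x i)).
Qed.

Lemma measurable_joint_density B d' (S : measurableType d') (p f u : S -> E) :
  measurable_fun setT p -> measurable_fun setT f -> measurable_fun setT u ->
  measurable_fun setT (fun s => joint_density B (p s) (f s) (u s)).
Proof.
move=> mp mf mu'; apply: measurable_funM.
  apply: measurable_funM; first exact: measurable_cst.
  by apply: measurable_funX; exact: measurable_overlap.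
by apply: measurable_prod => i _; exact: measurable_born.
Qed.

(** For a unit vector [p] the projections are Bernoulli trials with success probability |<u|p>|^2,
    so [B] enters only through its cardinality. *)
Lemma joint_densityE B p f u : sqnorm p = 1%R -> joint_density B p f u =
  ('C(M + d.+2 - 1, d.+2 - 1)%:R * overlap u f ^+ M *
    (overlap u p ^+ #|B| * (1 - overlap u p) ^+ (N - #|B|)))%R.
Proof.
move=> p1; congr (_ * _)%R.
rewrite (bigID (mem B))/=; congr (_ * _)%R.
  under eq_bigr => i iB do rewrite iB bornT.
  by rewrite prodr_const.
under eq_bigr => i iB do rewrite (negbTE iB) bornF p1.
rewrite prodr_const; congr (_ ^+ _)%R.
have -> : (N - #|B| = #|~: B|)%N by rewrite [RHS]cardsCs finset.setCK card_ord.
by apply: eq_card => i; rewrite !inE.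
Qed.

Lemma joint_density_ge0 B p f u : sqnorm p = 1%R -> sqnorm u = 1%R ->
  (0 <= joint_density B p f u)%R.
Proof.
move=> p1 u1; rewrite joint_densityE//.
have := overlap_le u p; rewrite u1 p1 mulr1 => le1.
rewrite !mulr_ge0// ?exprn_ge0// ?overlap_ge0// ?subr_ge0//.
Qed.

(* The absolute value is harmless, as the density is nonnegative on unit
   vectors; it makes the Tonelli theorem applicable. *)
Definition likelihood B (p f : 'cV[R[i]]_d.+2) : \bar R :=
  \int[mu]_g (`|joint_density B p f (orbit g)|%R)%:E.

Lemma likelihood_ge0 B p f : 0 <= likelihood B p f.
Proof. by apply: integral_ge0 => g _; rewrite lee_fin. Qed.

Let measurable_psi : measurable_fun setT (psi : T -> E).
Proof. exact: measurable_funPT. Qed.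

Let measurable_phi : measurable_fun setT (phi : T -> E).
Proof. exact: measurable_funPT. Qed.

Let measurable_pp : measurable_fun setT (fun w => (psi w, phi w) : E * E).
Proof. exact: measurable_fun_pair. Qed.

Lemma measurable_likelihood B :
  measurable_fun setT (fun w => likelihood B (psi w) (phi w)).
Proof.
pose F (z : T * G) : \bar R := (`|joint_density B (psi z.1) (phi z.1) (orbit z.2)|%R)%:E.
have mF : measurable_fun setT F.
  apply/measurable_EFinP/measurableT_comp => //.
  apply: measurable_joint_density.
  - exact: measurableT_comp.
  - exact: measurableT_comp.
  - by apply: (measurableT_comp (measurable_orbit ket0)).
by apply: (@measurable_fun_fubini_tonelli_F _ _ _ _ _ mu F) => // z; rewrite lee_fin.
Qed.

Lemma integral_outcome_indic B (A : set (E * E)) : measurable A ->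
  \int[P]_w ((\1_A (psi w, phi w))%:E * (\1_(outcome B) w)%:E) =
  \int[P]_w ((\1_A (psi w, phi w))%:E * likelihood B (psi w) (phi w)).
Proof.
move=> mA.
pose A' : set (E * E) := A `&` ([set v : E | sqnorm (v : 'cV[R[i]]_d.+2) = 1%R] `*` setT).
have mA' : measurable A' by apply: measurableI => //; exact: measurableX.
have m1 (C : set (E * E)) : measurable C ->
    measurable_fun setT (fun w => (\1_C (psi w, phi w) : R)%:E).
  by move=> mC; apply/measurable_EFinP/measurableT_comp => //; exact: measurable_indic.
have aeA (h : T -> \bar R) : measurable_fun setT h -> (forall w, 0 <= h w) ->
    \int[P]_w ((\1_A (psi w, phi w))%:E * h w) =
    \int[P]_w ((\1_A' (psi w, phi w))%:E * h w).
  move=> mh h0; apply: ge0_ae_eq_integral => //.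
  - by apply: emeasurable_funM => //; exact: m1.
  - by apply: emeasurable_funM => //; exact: m1.
  - by move=> w _; rewrite mule_ge0// lee_fin.
  - by move=> w _; rewrite mule_ge0// lee_fin.
  move: ae_psi; apply: filterS => w p1 _; congr (_%:E * _).
  rewrite !indicE; congr (_%:R); congr nat_of_bool.
  by apply/idP/idP; rewrite !inE /A' /=; [|case].
rewrite aeA; last 2 first.
- by apply/measurable_EFinP/measurable_indic; exact: measurable_outcome.
- by move=> w; rewrite lee_fin.
rewrite (aeA (fun w => likelihood B (psi w) (phi w))); last 2 first.
- exact: measurable_likelihood.
- by move=> w; exact: likelihood_ge0.
(* The estimate is left unconstrained, so [ep_outcomes] at [D] integrates it out. *)
pose D : set (E * E * G) := A' `*` setT.
have mD : measurable D by exact: measurableX.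
transitivity (P [set w | D (psi w, phi w, V w) /\ forall i, x i w = (i \in B)]).
  have mAP : measurable ((fun w => (psi w, phi w)) @^-1` A').
    by rewrite -[X in measurable X]setTI; exact: measurable_pp.
  rewrite (_ : [set w | _] = ((fun w => (psi w, phi w)) @^-1` A') `&` outcome B).
    rewrite -[X in _ = P X]setIT -integral_indic//; last first.
      by apply: measurableI => //; exact: measurable_outcome.
    apply: eq_integral => w _; rewrite -EFinM [X in _ = (X w)%:E]indicI /= !indicE.
    by congr (((nat_of_bool _)%:R * _)%:E); apply/idP/idP; rewrite !inE.
  apply/seteqP; split=> w; rewrite /D/=.
    by move=> [[]].
  by move=> [].
rewrite (ep_outcomes H)//; apply: eq_integral => w _.
rewrite indicE; have [wA|wA] := boolP (_ \in A').
  rewrite mul1e; apply: ae_eq_integral => //.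
  - apply/measurable_EFinP/measurable_funM.
      apply: measurableT_comp; first exact: measurable_indic.
      by apply: measurable_fun_pair.
    apply: (measurable_joint_density B).
    + exact: measurable_cst.
    + exact: measurable_cst.
    + exact: measurable_orbit.
  - apply/measurable_EFinP/measurableT_comp => //.
    apply: (measurable_joint_density B).
    + exact: measurable_cst.
    + exact: measurable_cst.
    + exact: measurable_orbit.
  move: (ae_sqnorm_orbit haar sqnorm_ket0); apply: filterS => g g1 _.
  have pA : sqnorm (psi w : 'cV[R[i]]_d.+2) = 1%R.
    by move: wA; rewrite inE /A' /= => -[_ []].
  rewrite indicE (_ : (_ \in D) = true); last by apply: mem_set; split=> //; exact: set_mem wA.
  by rewrite mul1r ger0_norm// joint_density_ge0.
rewrite mul0e integral0_eq// => g _.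
rewrite indicE (_ : (_ \in D) = false) ?mul0r//.
by apply/negbTE; apply: contra wA; rewrite !inE => -[].
Qed.

Let k1 := sqnorm_ket0.

Let measurable_orbit_ket0 : measurable_fun setT (fun g : G => orbit g : E).
Proof. exact: measurable_orbit. Qed.

(** Tonelli moves the integral over the estimate outermost, with two independent Haar orbits for psi
    and phi inside. This allows averaging over phi first, for fixed psi and fixed estimate. *)
Lemma integral_outcome B (f : E * E -> R) :
  measurable_fun setT f -> (forall z, (0 <= f z)%R) ->
  \int[P]_w ((f (psi w, phi w))%:E * (\1_(outcome B) w)%:E) =
  \int[mu]_g \int[mu]_g1 \int[mu]_g2
    (f (orbit g1, orbit g2) * `|joint_density B (orbit g1) (orbit g2) (orbit g)|)%:E.
Proof.
move=> mf f0.
transitivity (\int[P]_w ((f (psi w, phi w))%:E * likelihood B (psi w) (phi w))).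
  apply: (eq_weighted_integral measurable_pp) => //.
  - by apply/measurable_EFinP/measurable_indic; exact: measurable_outcome.
  - exact: measurable_likelihood.
  - by move=> w; exact: likelihood_ge0.
  - by move=> A mA; exact: integral_outcome_indic.
pose F (z : E * E * G) : \bar R := (f z.1 * `|joint_density B z.1.1 z.1.2 (orbit z.2)|)%:E.
have F0 z : 0 <= F z by rewrite lee_fin mulr_ge0.
have mF : measurable_fun setT F.
  apply/measurable_EFinP/measurable_funM; first exact: measurableT_comp.
  apply/measurableT_comp => //; apply: (measurable_joint_density B).
  - by apply: measurableT_comp.
  - by apply: measurableT_comp.
  - by apply: (measurableT_comp measurable_orbit_ket0).
transitivity (\int[P]_w \int[mu]_g F ((psi w, phi w), g)).
  apply: eq_integral => w _; rewrite /likelihood -ge0_integralZl_EFin//.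
  apply/measurable_EFinP/measurableT_comp => //.
  apply: (measurable_joint_density B) => //; exact: measurable_cst.
have mF' : measurable_fun setT (fun z : T * G => F ((psi z.1, phi z.1), z.2)).
  apply: (measurableT_comp mF).
  apply/measurable_fun_pair => //.
  by apply: (measurableT_comp measurable_pp).
rewrite (fubini_tonelli (m1 := P) (m2 := mu) _ mF') => [|z]; last exact: F0.
apply: eq_integral => g _ /=.
rewrite (integral_states (F := fun z => F (z, g)))//.
exact: (measurableT_comp mF (measurable_pair2 g)).
Qed.

(** The last hypothesis says that averaging f over phi, weighted by the covariant density, is affine
    in q = |<u|p>|^2. Integrating over psi against q^k (1-q)^(N-k), with k the size of [B], gives
    two Beta moments, and the result no longer depends on the estimate. *)
Lemma mean_affine_outcome B (f : E * E -> R) (a b : R) :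
  measurable_fun setT f -> (forall z, (0 <= f z)%R) ->
  (forall p, ae_bounded mu (fun g => f (p, orbit g))) ->
  (forall p u : 'cV[R[i]]_d.+2, sqnorm p = 1%R -> sqnorm u = 1%R ->
    'C(M + d.+2 - 1, d.+2 - 1)%:R *
      mean mu (fun g => overlap u (orbit g) ^+ M * f (p, orbit g)) =
    a + b * overlap u p)%R ->
  \int[P]_w ((f (psi w, phi w))%:E * (\1_(outcome B) w)%:E) =
  (let bm := beta_moment (haar_moment mu ket0) in
   a * bm #|B| (N - #|B|)%N + b * bm #|B|.+1 (N - #|B|)%N)%:E.
Proof.
move=> mf f0 bf fab; rewrite integral_outcome//.
set K := (N - #|B|)%N; set m := #|B|.
pose F (z : G * G * G) : \bar R :=
  (f (orbit z.1.2, orbit z.2) * `|joint_density B (orbit z.1.2) (orbit z.2) (orbit z.1.1)|)%:E.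
have F0 z : 0 <= F z by rewrite lee_fin mulr_ge0.
have mF : measurable_fun setT F.
  have mo2 : measurable_fun setT (fun z : G * G * G => orbit z.2 : E).
    by apply: (measurableT_comp measurable_orbit_ket0).
  have mo12 : measurable_fun setT (fun z : G * G * G => orbit z.1.2 : E).
    by apply: (measurableT_comp measurable_orbit_ket0); apply: measurableT_comp.
  have mo11 : measurable_fun setT (fun z : G * G * G => orbit z.1.1 : E).
    by apply: (measurableT_comp measurable_orbit_ket0); apply: measurableT_comp.
  apply/measurable_EFinP/measurable_funM.
    by apply: (measurableT_comp mf); exact: measurable_fun_pair.
  by apply/measurableT_comp => //; exact: (measurable_joint_density B).
pose F1 (z : G * G) := \int[mu]_g2 F (z, g2).
have F10 z : 0 <= F1 z by apply: integral_ge0.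
have mF1 : measurable_fun setT F1.
  exact: (@measurable_fun_fubini_tonelli_F _ _ _ _ _ mu F).
pose F2 (g : G) := \int[mu]_g1 F1 (g, g1).
have mF2 : measurable_fun setT F2.
  exact: (@measurable_fun_fubini_tonelli_F _ _ _ _ _ mu F1).
pose q (u : 'cV[R[i]]_d.+2) (g1 : G) : R := overlap u (orbit g1).
have bq u : ae_bounded mu (q u) by exact: ae_bounded_overlap_orbit.
pose r u g1 : R := (a * (q u g1 ^+ m * (1 - q u g1) ^+ K) +
                    b * (q u g1 ^+ m.+1 * (1 - q u g1) ^+ K))%R.
have bqq u m' : ae_bounded mu (fun g1 => q u g1 ^+ m' * (1 - q u g1) ^+ K)%R.
  apply: ae_boundedM; apply: ae_boundedX => //.
  by apply: ae_boundedB => //; exact: ae_bounded_cst.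
have br u : ae_bounded mu (r u).
  by apply: ae_boundedD; apply: ae_boundedM => //; exact: ae_bounded_cst.
have F1E g g1 : sqnorm (orbit g) = 1%R -> sqnorm (orbit g1) = 1%R ->
    F1 (g, g1) = (r (orbit g) g1)%:E.
  move=> u1 p1.
  set u := orbit g; set p := orbit g1.
  have -> : F1 (g, g1) = \int[mu]_g2 ((overlap u p ^+ m * (1 - overlap u p) ^+ K *
      ('C(M + d.+2 - 1, d.+2 - 1)%:R * (overlap u (orbit g2) ^+ M * f (p, orbit g2))))%R%:E).
    apply: eq_integral => g2 _; rewrite /F /= ger0_norm; last exact: joint_density_ge0.
    by congr (_%:E); rewrite joint_densityE// -/u -/p -/m -/K; ring.
  have bOf : ae_bounded mu (fun g2 => overlap u (orbit g2) ^+ M * f (p, orbit g2))%R.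
    apply: ae_boundedM => //; apply: ae_boundedX; exact: bq.
  rewrite mean_integral; last first.
    by apply: ae_boundedM; [exact: ae_bounded_cst|apply: ae_boundedM => //; exact: ae_bounded_cst].
  congr (_%:E); rewrite !meanZ//; last first.
    by apply: ae_boundedM => //; exact: ae_bounded_cst.
  by rewrite fab// /r /q -/u -/p exprS; ring.
have F2E g : sqnorm (orbit g) = 1%R -> F2 g = (a * beta_moment (haar_moment mu ket0) m K +
    b * beta_moment (haar_moment mu ket0) m.+1 K)%:E.
  move=> u1.
  transitivity (\int[mu]_g1 (r (orbit g) g1)%:E).
    apply: (@ae_eq_integral _ _ _ mu setT _ (fun g1 => F1 (g, g1))).
    - exact: measurableT.
    - exact: (@measurable_fun_pair2 _ _ _ _ _ _ F1 g mF1).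
    - by apply/measurable_EFinP; case: (br (orbit g)).
    move: (ae_sqnorm_orbit haar k1); apply: filterS => g1 p1 _.
    exact: F1E.
  rewrite mean_integral//; congr (_%:E); rewrite meanD; last 2 first.
  - by apply: ae_boundedM => //; exact: ae_bounded_cst.
  - by apply: ae_boundedM => //; exact: ae_bounded_cst.
  by rewrite !meanZ// !(mean_overlap_beta haar k1).
transitivity (\int[mu]_g F2 g) => //.
transitivity (\int[mu]_(g in [set: G]) (a * beta_moment (haar_moment mu ket0) m K +
    b * beta_moment (haar_moment mu ket0) m.+1 K)%:E).
  apply: (@ae_eq_integral _ _ _ mu setT _ F2).
  - exact: measurableT.
  - exact: mF2.
  - exact: measurable_cst.
  by move: (ae_sqnorm_orbit haar k1); apply: filterS => g u1 _; exact: F2E.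
by rewrite integral_cst//= probability_setT mule1.
Qed.

Local Open Scope ring_scope.

Local Notation bm := (beta_moment (haar_moment mu ket0)).

Lemma ae_bounded_overlap_states :
  ae_bounded P (fun w => overlap (psi w : 'cV[R[i]]_d.+2) (phi w : 'cV[R[i]]_d.+2)).
Proof.
split; first exact: measurable_overlap.
exists 1; move: ae_psi ae_phi; apply: filterS2 => w p1 f1.
rewrite ger0_norm ?overlap_ge0//; apply: (le_trans (overlap_le _ _)).
by rewrite p1 f1 mulr1.
Qed.

Lemma ae_bounded_outcome B : ae_bounded P (\1_(outcome B)).
Proof. exact/ae_bounded_indic/measurable_outcome. Qed.

(** The probability of one particular set of successes, hence without a binomial coefficient. It is
    the case f = 1 of [mean_affine_outcome], with a = 1 and b = 0. *)
Lemma mean_outcome B : mean P (\1_(outcome B)) = bm #|B| (N - #|B|)%N.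
Proof.
apply: EFin_inj; rewrite -mean_integral; last exact: ae_bounded_outcome.
transitivity (\int[P]_w (((fun=> 1) (psi w, phi w))%:E * (\1_(outcome B) w)%:E))%E.
  by apply: eq_integral => w _; rewrite mul1e.
rewrite (@mean_affine_outcome B (fun=> 1) 1 0)/=.
- by rewrite mul0r addr0 mul1r.
- exact: measurable_cst.
- by [].
- by move=> p; exact: ae_bounded_cst.
move=> p u p1 u1; under mean_ext do rewrite mulr1.
by rewrite (mean_overlap_unit haar ket0)// (binomial_haar_moment haar k1) mul0r addr0.
Qed.

(** Given psi and the estimate, c has mean (1 + M q)/(M + d); [beta_momentS] with k + l = N then
    replaces q by (k+1)/(N+d). *)
Lemma mean_overlap_outcome B :
  mean P (fun w => overlap (psi w : 'cV[R[i]]_d.+2) (phi w : 'cV[R[i]]_d.+2) *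
                   \1_(outcome B) w) =
  c_ep R d.+2 N M #|B| * mean P (\1_(outcome B)).
Proof.
have leB : (#|B| <= N)%N by rewrite -[X in (_ <= X)%N]card_ord max_card.
have Md : (M + d.+2)%:R != 0 :> R by rewrite pnatr_eq0 addnS.
apply: EFin_inj; rewrite -mean_integral; last first.
  by apply: ae_boundedM; [exact: ae_bounded_overlap_states|exact: ae_bounded_outcome].
pose f (z : E * E) : R := overlap (z.1 : 'cV[R[i]]_d.+2) (z.2 : 'cV[R[i]]_d.+2).
transitivity (\int[P]_w ((f (psi w, phi w))%:E * (\1_(outcome B) w)%:E))%E.
  by apply: eq_integral => w _; rewrite EFinM.
(* The constants come from [mean_overlapXM] at n = M, divided by M+1, with m_(M+1) expressed through
   m_M. *)
rewrite (@mean_affine_outcome B f ((M + d.+2)%:R^-1) (M%:R / (M + d.+2)%:R)).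
- congr (_%:E); rewrite mean_outcome /=.
  have := @beta_momentS _ _ d.+2 isT (haar_momentS haar k1) #|B| (N - #|B|)%N.
  rewrite (subnKC leB) => bS.
  have Nd : (N + d.+2)%:R != 0 :> R by rewrite pnatr_eq0 addnS.
  have -> : bm #|B|.+1 (N - #|B|)%N = #|B|.+1%:R * bm #|B| (N - #|B|)%N / (N + d.+2)%:R.
    by rewrite -bS mulrC mulKf.
  rewrite /c_ep natrM !natrD natrM natrD -[#|B|.+1%:R]natr1; move: Md Nd; rewrite !natrD.
  move: (d.+2%:R : R) => D Md Nd.
  by field; rewrite ![D + _]addrC Md Nd.
- exact: measurable_overlap.
- by move=> z; exact: overlap_ge0.
- by move=> p; exact: (ae_bounded_overlap_orbit haar k1).
move=> p u p1 u1.
have /(congr1 (fun z => M.+1%:R^-1 * z)) := mean_overlapXM haar k1 p M u1.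
rewrite mulKf ?pnatr_eq0// => ->.
have hS : haar_moment mu ket0 M.+1 =
    M.+1%:R * haar_moment mu ket0 M / (M + d.+2)%:R.
  by rewrite -(haar_momentS haar k1) mulrC mulKf.
rewrite hS p1.
transitivity (('C(M + d.+2 - 1, d.+2 - 1)%:R * haar_moment mu ket0 M) *
   ((1 + M%:R * overlap u p) / (M + d.+2)%:R)).
  move: Md (pnatr_eq0 R M.+1) => /=; rewrite natrD -[M.+1%:R]natr1.
  by move: (d.+2%:R : R) => D Md M1; field; rewrite Md M1.
by rewrite (binomial_haar_moment haar k1) mul1r mulrDl mul1r mulrAC.
Qed.

Lemma mean_overlap_states_sqr :
  mean P (fun w => overlap (psi w : 'cV[R[i]]_d.+2) (phi w : 'cV[R[i]]_d.+2) ^+ 2) =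
  haar_moment mu ket0 2.
Proof.
apply: EFin_inj; rewrite -mean_integral; last exact/ae_boundedX/ae_bounded_overlap_states.
pose f (z : E * E) : \bar R :=
  (overlap (z.1 : 'cV[R[i]]_d.+2) (z.2 : 'cV[R[i]]_d.+2) ^+ 2)%:E.
have f0 z : (0 <= f z)%E by rewrite lee_fin exprn_ge0// overlap_ge0.
have mf : measurable_fun setT f.
  by apply/measurable_EFinP/measurable_funX/measurable_overlap.
rewrite (integral_states (F := f))//.
transitivity (\int[mu]_(g in [set: G]) (haar_moment mu ket0 2)%:E)%E.
  apply: ae_eq_integral => //.
    apply: (@measurable_fun_fubini_tonelli_F _ _ _ _ _ mu
      (fun z : G * G => f (orbit z.1, orbit z.2))) => //.
    apply: (measurableT_comp mf).
    apply/measurable_fun_pair; exact: (measurableT_comp measurable_orbit_ket0).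
  move: (ae_sqnorm_orbit haar k1); apply: filterS => g u1 _.
  rewrite /f /= mean_integral.
    by rewrite (mean_overlap_unit haar ket0).
  exact/ae_boundedX/ae_bounded_overlap_orbit.
by rewrite integral_cst//= probability_setT mule1.
Qed.

End Outcomes.

(** * Estimators *)

Section BinomialSums.
Variables (K : comNzRingType) (N : nat) (q : K).

Local Notation weight B := (q ^+ #|B| * (1 - q) ^+ (N - #|B|)).

(** The probability generating function of the number of successes given q. Its value and first two
    derivatives at 1 yield the three sums below. *)
Lemma binomial_gf : (q *: 'X + (1 - q)%:P) ^+ N =
  \sum_(B : {set 'I_N}) weight B *: 'X^#|B|.
Proof.
rewrite -[in LHS](card_ord N) -prodr_const.
rewrite (@bigA_distr _ _ _ _ _ _ (fun=> q *: 'X) (fun=> (1 - q)%:P)).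
apply: eq_bigr => B _; rewrite (bigID (mem B))/=.
under eq_bigr => i iB do rewrite iB.
rewrite prodr_const (eq_bigr (fun=> (1 - q)%:P)) => [|i /negbTE -> //].
rewrite prodr_const.
have -> : #|(fun i : 'I_N => i \notin B)| = (N - #|B|)%N.
  have -> : (N - #|B| = #|~: B|)%N by rewrite [RHS]cardsCs finset.setCK card_ord.
  by apply: eq_card => i; rewrite !inE.
by rewrite exprZn -polyC_exp mulrC mul_polyC scalerA mulrC.
Qed.

Let L := q *: 'X + (1 - q)%:P.

Let L1 : L.[1] = 1.
Proof. by rewrite /L hornerD hornerZ hornerX hornerC; ring. Qed.

Let dL : L^`() = q%:P.
Proof. by rewrite /L derivD derivZ derivX derivC addr0 alg_polyC. Qed.

Lemma binomial_sum0 : \sum_(B : {set 'I_N}) weight B = 1.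
Proof.
have /(congr1 (horner^~ 1)) := binomial_gf.
rewrite -/L horner_exp L1 expr1n horner_sum => Hs; rewrite [RHS]Hs.
by apply: eq_bigr => B _; rewrite hornerZ hornerXn expr1n mulr1.
Qed.

Lemma binomial_sum1 : \sum_(B : {set 'I_N}) weight B * #|B|%:R = N%:R * q.
Proof.
have /(congr1 (fun p => (p^`()).[1])) := binomial_gf.
rewrite -/L deriv_exp dL hornerMn hornerM horner_exp L1 expr1n hornerC mulr1.
rewrite -mulr_natl => ->; rewrite raddf_sum horner_sum.
by apply: eq_bigr => B _; rewrite /= derivZ derivXn hornerZ hornerMn hornerXn expr1n.
Qed.

Lemma binomial_sum2 : \sum_(B : {set 'I_N}) weight B * (#|B| * #|B|.-1)%:R =
  N%:R * N.-1%:R * q ^+ 2.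
Proof.
have /(congr1 (fun p => (p^`()^`()).[1])) := binomial_gf.
rewrite -/L deriv_exp dL derivMn mul_polyC derivZ deriv_exp dL.
rewrite hornerMn hornerZ hornerMn hornerM horner_exp L1 expr1n hornerC mulr1.
move=> Hs; transitivity ((q * (q *+ N.-1)) *+ N); last first.
  by rewrite -[q *+ _]mulr_natl -mulr_natl; ring.
rewrite Hs !raddf_sum horner_sum.
apply: eq_bigr => B _.
rewrite /= derivZ derivXn derivZ derivMn derivXn hornerZ !hornerMn hornerXn expr1n.
by rewrite -mulrnA mulnC.
Qed.

End BinomialSums.

(** * Sums of Beta moments over outcomes and the mean square error *)

Section BetaSums.
Context (R : realType) (d N : nat).
Variable mu : probability (borelM R d.+2 d.+2) R.
Hypothesis haar : is_haar mu.
Variable k : 'cV[R[i]]_d.+2.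
Hypothesis k1 : sqnorm k = 1.

Local Notation orbit g := ((g : 'M[R[i]]_d.+2) *m k).
Local Notation hm := (haar_moment mu k).
Local Notation bm := (beta_moment hm).

Lemma haar_moment1 : hm 1 = (d.+2%:R)^-1.
Proof.
have := haar_momentS haar k1 0; rewrite haar_moment0 mulr1 add0n => e.
by apply: (@mulfI _ d.+2%:R); rewrite ?e ?mulfV ?pnatr_eq0.
Qed.

Lemma haar_moment2 : hm 2 = 2 / (d.+2%:R * (d.+2%:R + 1)).
Proof.
have := haar_momentS haar k1 1; rewrite haar_moment1 add1n => e.
have d3 : d.+3%:R != 0 :> R by rewrite pnatr_eq0.
have -> : hm 2 = 2 * d.+2%:R^-1 / d.+3%:R by rewrite -e mulrAC mulfV// mul1r.
by rewrite -[d.+3%:R]natr1 invfM mulrA.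
Qed.

(** An identity valid for every q may be averaged over q = |<u|phi>|^2 with phi Haar-random, which
    turns the binomial weights into Beta moments. *)
Lemma sum_beta_moment (w : nat -> R) (a b c : R) :
  (forall q : R, \sum_(B : {set 'I_N}) (q ^+ #|B| * (1 - q) ^+ (N - #|B|)) * w #|B| =
    a + b * q + c * q ^+ 2) ->
  \sum_(B : {set 'I_N}) bm #|B| (N - #|B|) * w #|B| = a + b * hm 1 + c * hm 2.
Proof.
move=> wq; pose u : 'cV[R[i]]_d.+2 := delta_mx 0 0.
have u1 : sqnorm u = 1 by exact: sqnorm_delta.
have bO := ae_bounded_overlap_orbit haar k1 u.
have bc e : ae_bounded mu (fun=> e : R) by exact: ae_bounded_cst.
have bw m l : ae_bounded mu (fun g =>
    overlap u (orbit g) ^+ m * (1 - overlap u (orbit g)) ^+ l).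
  by apply: ae_boundedM; apply: ae_boundedX => //; exact: ae_boundedB.
under eq_bigr => B _ do
  rewrite -(mean_overlap_beta haar k1 u1) mulrC -(meanZ _ (bw _ _)).
rewrite -mean_sum => [|B]; last exact: ae_boundedM.
under mean_ext => g do under eq_bigr do rewrite mulrC.
under mean_ext => g do rewrite wq.
rewrite !meanD//; [|exact: ae_boundedM|apply: ae_boundedD => //; exact: ae_boundedM|
  by apply: ae_boundedM => //; exact: ae_boundedX].
by rewrite mean_cst !meanZ//; exact: ae_boundedX.
Qed.

(* (a + b k)^2 is split into 1, k and k(k-1), whose binomial means given q are
   1, N q and N(N-1) q^2. *)
Lemma sum_affine_sqr_beta (a b : R) :
  \sum_(B : {set 'I_N}) bm #|B| (N - #|B|) * (a + b * #|B|%:R) ^+ 2 =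
  a ^+ 2 + (2 * a * b + b ^+ 2) * N%:R * hm 1 + b ^+ 2 * (N%:R * N.-1%:R) * hm 2.
Proof.
rewrite (@sum_beta_moment (fun m => (a + b * m%:R) ^+ 2) (a ^+ 2)
  ((2 * a * b + b ^+ 2) * N%:R) (b ^+ 2 * (N%:R * N.-1%:R)))// => q.
have sq m : (a + b * m%:R) ^+ 2 =
    a ^+ 2 + (2 * a * b + b ^+ 2) * m%:R + b ^+ 2 * (m * m.-1)%:R.
  by case: m => [|m] /=; rewrite ?mul0n ?natrM -?natr1; ring.
have expand (y a' b' c' m n : R) :
    y * (a' + b' * m + c' * n) = a' * y + b' * (y * m) + c' * (y * n) by ring.
under eq_bigr do rewrite sq expand.
rewrite !big_split /= -!mulr_sumr.
by rewrite binomial_sum0 binomial_sum1 binomial_sum2 mulr1 !mulrA.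
Qed.

(** As c(k) is a posterior mean, its mean square error is E c^2 - E c(k)^2, evaluated here in closed
    form. *)
Lemma beta_variance M :
  hm 2 - \sum_(B : {set 'I_N}) bm #|B| (N - #|B|) * c_ep R d.+2 N M #|B| ^+ 2 =
  v_ep R d.+2 N M.
Proof.
pose D : R := d.+2%:R.
have M0 : D + M%:R != 0 by rewrite -natrD pnatr_eq0.
have N0 : D + N%:R != 0 by rewrite -natrD pnatr_eq0.
have cE m : c_ep R d.+2 N M m =
   (D + N%:R + M%:R) / ((D + M%:R) * (D + N%:R)) +
   M%:R / ((D + M%:R) * (D + N%:R)) * m%:R.
  rewrite /c_ep natrM !natrD natrM natrD; move: M0 N0; rewrite /D.
  by move: (d.+2%:R : R) => D' M0 N0; field; rewrite M0 N0.
under eq_bigr do rewrite cE.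
rewrite sum_affine_sqr_beta haar_moment1 haar_moment2 /v_ep -/D.
have D0 : D != 0 by rewrite pnatr_eq0.
have D1 : D + 1 != 0 by rewrite natr1 pnatr_eq0.
(* The factor N makes the truncated predecessor agree with N - 1 also at N = 0. *)
have -> : N%:R * N.-1%:R = N%:R * (N%:R - 1) :> R.
  by case: (N) => [|n]; rewrite ?mul0r// -natr1 addrK.
move: (N%:R : R) (M%:R : R) D M0 N0 D0 D1 {cE} => n m D M0 N0 D0 D1.
by field; rewrite D0 D1 M0 N0.
Qed.

End BetaSums.

(** Lets statements about outcome sets be specialized to any number k <= N of successes. *)
Lemma exists_set_card (N k : nat) : (k <= N)%N -> exists B : {set 'I_N}, #|B| = k.
Proof.
rewrite -[X in (_ <= X)%N]card_ord => /card_geqP[s [us <- _]].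
by exists [set i in s]%SET; rewrite cardsE; apply/card_uniqP.
Qed.

(** * Optimality and the posterior mean *)

Section Decision.
Context (R : realType) (d N M : nat).
Variable mu : probability (borelM R d.+2 d.+2) R.
Variable ket0 : 'cV[R[i]]_d.+2.
Context (disp : measure_display) (T : measurableType disp).
Variable P : probability T R.
Variables (psi phi : {RV P >-> borelM R d.+2 1}) (V : {RV P >-> borelM R d.+2 d.+2}).
Variable x : 'I_N -> {RV P >-> bool}.
Hypothesis H : estimate_and_project M mu ket0 psi phi V x.

Let haar := ep_haar H.
Let k1 := sqnorm_ket0 H.

Local Notation bm := (beta_moment (haar_moment mu ket0)).
Local Notation c w := (overlap (psi w : 'cV[R[i]]_d.+2) (phi w : 'cV[R[i]]_d.+2)).
Local Notation cep := (c_ep R d.+2 N M).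
Local Notation weight B := (bm #|B| (N - #|B|)%N).

Let bc : ae_bounded P (fun w => c w).
Proof. exact: ae_bounded_overlap_states H. Qed.

Let bo B : ae_bounded P (\1_(outcome x B)).
Proof. exact: ae_bounded_outcome. Qed.

Let bco B : ae_bounded P (fun w => c w * \1_(outcome x B) w).
Proof. exact: ae_boundedM. Qed.

(** Every outcome has positive probability. This forces the optimum to be unique on 0, ..., N and
    justifies the division in the posterior mean. *)
Lemma weight_gt0 (B : {set 'I_N}) : 0 < weight B.
Proof.
apply: (@beta_moment_gt0 _ _ d.+2) => //; first exact: (haar_momentS haar k1).
by rewrite haar_moment0.
Qed.

(** The events [outcome x B] partition the sample space, so exactly one term survives. *)
Lemma sum_outcome (f : {set 'I_N} -> R) w :
  f [set i | x i w]%SET = \sum_(B : {set 'I_N}) f B * \1_(outcome x B) w.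
Proof.
rewrite (bigD1 [set i | x i w]%SET)//= big1 ?addr0 => [|B nB].
  by rewrite indicE mem_set ?mulr1// => i; rewrite inE.
rewrite indicE memNset ?mulr0// => xB; move/eqP: nB; apply.
by apply/setP => i; rewrite inE -xB.
Qed.

Lemma mean_estimator (f : {set 'I_N} -> R) :
  mean P (fun w => f [set i | x i w]%SET) = \sum_B f B * weight B.
Proof.
under mean_ext do rewrite sum_outcome.
rewrite mean_sum => [|B]; last by apply: ae_boundedM => //; exact: ae_bounded_cst.
by apply: eq_bigr => B _; rewrite meanZ// (mean_outcome H).
Qed.

Lemma mean_estimator_overlap (f : {set 'I_N} -> R) :
  mean P (fun w => f [set i | x i w]%SET * c w) = \sum_B f B * (cep #|B| * weight B).
Proof.
under mean_ext do rewrite sum_outcome mulr_suml.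
under mean_ext => w do under eq_bigr => B _ do rewrite -mulrA [_ * c w]mulrC.
rewrite mean_sum => [|B]; last by apply: ae_boundedM => //; exact: ae_bounded_cst.
by apply: eq_bigr => B _; rewrite meanZ// (mean_overlap_outcome H) (mean_outcome H).
Qed.

Let bf (f : {set 'I_N} -> R) : ae_bounded P (fun w => f [set i | x i w]%SET).
Proof.
under eq_fun do rewrite sum_outcome.
by apply: ae_bounded_sum => B; apply: ae_boundedM => //; exact: ae_bounded_cst.
Qed.

Lemma mean_square_errorE (est : nat -> R) :
  mean_square_error psi phi x est =
  (v_ep R d.+2 N M +
   \sum_(B : {set 'I_N}) weight B * (est #|B| - cep #|B|) ^+ 2)%:E.
Proof.
rewrite /mean_square_error unlock.
pose f (B : {set 'I_N}) := est #|B|.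
transitivity (\int[P]_w ((f [set i | x i w]%SET - c w) ^+ 2)%:E)%E => //.
rewrite mean_integral; last by apply: ae_boundedX; exact: ae_boundedB.
congr (_%:E).
transitivity (mean P (fun w => f [set i | x i w]%SET ^+ 2 +
    (- 2 * (f [set i | x i w]%SET * c w) + c w ^+ 2))).
  by apply: mean_ext => w; ring.
have b2 : ae_bounded P (fun w => f [set i | x i w]%SET * c w) by exact: ae_boundedM.
have b3 : ae_bounded P (fun w => - 2 * (f [set i | x i w]%SET * c w)).
  by apply: ae_boundedM => //; exact: ae_bounded_cst.
have b4 : ae_bounded P (fun w => c w ^+ 2) by exact: ae_boundedX.
rewrite !meanD//; [|exact: ae_boundedX|exact: ae_boundedD].
rewrite meanZ// mean_estimator_overlap (mean_estimator (fun B => f B ^+ 2)).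
rewrite (mean_overlap_states_sqr H) -(beta_variance N haar k1 M).
set S := \sum_B f B ^+ 2 * _; set S' := \sum_B f B * _.
set Q := \sum_(B : {set 'I_N}) weight B * cep #|B| ^+ 2.
(* Completing the square: [mean_estimator_overlap] has replaced c by c(k) in the cross term, so only
   the constant terms E c^2 and E c(k)^2 differ, and their difference is [v_ep]. *)
have -> : \sum_(B : {set 'I_N}) weight B * (est #|B| - cep #|B|) ^+ 2 = S + (- 2 * S' + Q).
  rewrite /S /S' /Q mulr_sumr -!big_split; apply: eq_bigr => B _.
  by rewrite /f /=; ring.
by ring.
Qed.

Lemma mean_square_error_c_ep :
  mean_square_error psi phi x cep = (v_ep R d.+2 N M)%:E.
Proof.
rewrite mean_square_errorE big1 ?addr0// => B _.
by rewrite subrr expr0n mulr0.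
Qed.

(** Comparison with [c_ep] forces the weighted sum of squared deviations to vanish, and all weights
    are positive. Values beyond N stay free because at most N projections succeed. *)
Lemma optimal_estimatorP (est : nat -> R) :
  optimal_estimator psi phi x est <-> (forall k, (k <= N)%N -> est k = cep k).
Proof.
have t0 (e : nat -> R) (B : {set 'I_N}) : 0 <= weight B * (e #|B| - cep #|B|) ^+ 2.
  by rewrite mulr_ge0 ?sqr_ge0// ltW// weight_gt0.
split=> [opt k kN|eqc est'].
  have [B Bk] := exists_set_card kN.
  have := opt cep; rewrite mean_square_error_c_ep mean_square_errorE lee_fin.
  rewrite gerDl => le0.
  have /eqP : \sum_(B : {set 'I_N}) weight B * (est #|B| - cep #|B|) ^+ 2 = 0.
    by apply/eqP; rewrite eq_le le0 sumr_ge0.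
  rewrite psumr_eq0// => /allP/(_ B (mem_index_enum _)) /=.
  by rewrite mulf_eq0 sqrf_eq0 subr_eq0 gt_eqF ?weight_gt0//= Bk => /eqP.
rewrite !mean_square_errorE lee_fin lerD2l big1 ?sumr_ge0// => B _.
by rewrite eqc ?subrr ?expr0n ?mulr0// -[X in (_ <= X)%N]card_ord max_card.
Qed.

(** Numerator and denominator are sums over the sets [B] of size k, on which the conditional mean is
    the constant [c_ep]; the remaining common factor is positive and cancels. *)
Lemma posterior_meanE k : (k <= N)%N -> posterior_mean psi phi x k = cep k.
Proof.
move=> kN; have [B0 B0k] := exists_set_card kN.
pose f (B : {set 'I_N}) : R := (#|B| == k)%:R.
have indE w : \1_[set w | successes x w = k] w = f [set i | x i w]%SET :> R.
  by rewrite indicE /f; congr (nat_of_bool _)%:R; apply/idP/idP; rewrite inE /= => /eqP.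
have mS : measurable [set w | successes x w = k].
  apply/(measurable_indicP R); have [+ _] := bf f.
  by rewrite (_ : \1__ = fun w => f [set i | x i w]%SET)//; apply/funext => w.
rewrite /posterior_mean.
have -> : fine (P [set w | successes x w = k]) = \sum_B f B * weight B.
  rewrite -mean_estimator; congr fine.
  transitivity (\int[P]_w (\1_[set w | successes x w = k] w)%:E)%E.
    by rewrite integral_indic// setIT.
  by apply: eq_integral => w _; rewrite indE.
have -> : \int[P]_(w in [set w | successes x w = k]) c w =
    \sum_B f B * (cep #|B| * weight B).
  rewrite Rintegral_mkcond -mean_estimator_overlap; apply: mean_ext => w.
  by rewrite patch_indic /= indE mulrC.
have -> : \sum_B f B * (cep #|B| * weight B) = cep k * \sum_B f B * weight B.
  rewrite mulr_sumr; apply: eq_bigr => B _; rewrite /f.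
  by case: eqP => [->|_]; rewrite ?mul1r// !mul0r mulr0.
rewrite mulfK// gt_eqF// (bigD1 B0)//= ltr_pwDl//.
  by rewrite mulr_gt0 ?weight_gt0// /f B0k eqxx.
by apply: sumr_ge0 => B _; rewrite mulr_ge0// ltW// weight_gt0.
Qed.

End Decision.

(** * Asymptotics of the mean square error *)

Lemma v_ep_cvg_fixed_N (R : realType) (d N : nat) : (0 < d)%N ->
  v_ep R d N M @[M --> \oo] -->
    ((d%:R - 1) / (d%:R * (d%:R + 1) * (d%:R + N%:R)) : R).
Proof.
move=> d0; pose D : R := d%:R; pose y (M : nat) : R := (D + M%:R)^-1.
have D0 : 0 < D by rewrite ltr0n.
have ycvg : y M @[M --> \oo] --> (0 : R).
  apply/gtr0_cvgV0; first by apply: nearW => M; rewrite ltr_wpDr.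
  under eq_fun do rewrite -natrD.
  exact/cvgrnyP/cvg_addnl.
set K := (_ / _ : R).
(* With y = 1/(d+M), writing d + 2M = 2(d+M) - d makes the error polynomial in y. *)
rewrite [X in X @ _ --> _](_ : _ = fun M => K * (1 + N%:R * (2 * y M - D * y M ^+ 2))).
  rewrite [X in _ --> X](_ : _ = K * (1 + N%:R * (2 * 0 - D * 0 ^+ 2))); last by ring.
  apply: cvgM; first exact: cvg_cst.
  apply: cvgD; first exact: cvg_cst.
  apply: cvgM; first exact: cvg_cst.
  apply: cvgB; first by apply: cvgM => //; exact: cvg_cst.
  apply: cvgM; first exact: cvg_cst.
  by under eq_fun do rewrite expr2; rewrite expr2; exact: cvgM.
apply/funext => M; rewrite /v_ep /K /y -/D.
have N0 : D + N%:R != 0 by rewrite gt_eqF// ltr_wpDr.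
have M0 : D + M%:R != 0 by rewrite gt_eqF// ltr_wpDr.
have D1 : D + 1 != 0 by rewrite gt_eqF// ltr_wpDr.
move: D0; rewrite lt0r => /andP[D0 _].
move: (M%:R : R) (N%:R : R) D D0 D1 N0 M0 {y ycvg K} => m n D D0 D1 N0 M0.
by field; rewrite D0 D1 N0 M0.
Qed.

Lemma v_ep_equiv (R : realType) (d : nat) (delta : int) (N M : nat -> nat) :
  (0 < d)%N ->
  (forall n, (M n)%:Z - (N n)%:Z = delta) ->
  (M n + N n)%N @[n --> \oo] --> \oo ->
  (fun n => v_ep R d (N n) (M n) : R^o) ~_\oo
  (fun n => 6 * (d%:R - 1) / (d%:R * (d%:R + 1) * ((M n)%:R + (N n)%:R)) : R^o).
Proof.
move=> d0 MN MNoo.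
pose D : R := d%:R; pose e : R := delta%:~R.
have D0 : 0 < D by rewrite ltr0n.
have ME n : (M n)%:R = (N n)%:R + e :> R.
  by rewrite /e -(MN n) rmorphB /= !pmulrn; ring.
(* For a = d, b = M - N and t = 1/(d+N), the error is the claimed equivalent times a rational
   function of t alone. It is called [rho] below, and rho(0) = (1+2) * 2/6 = 1. *)
have alg (a b n : R) : a != 0 -> a + 1 != 0 -> a + n != 0 -> a + (n + b) != 0 ->
    n + b + n != 0 ->
    (a - 1) * ((a + (n + b)) ^+ 2 + (a + 2 * (n + b)) * n) /
      (a * (a + 1) * (a + (n + b)) ^+ 2 * (a + n)) =
    6 * (a - 1) / (a * (a + 1) * (n + b + n)) *
      (((1 + b * (a + n)^-1) ^+ 2 +
        (2 + (2 * b - a) * (a + n)^-1) * (1 - a * (a + n)^-1)) *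
      (2 + (b - 2 * a) * (a + n)^-1) / (6 * (1 + b * (a + n)^-1) ^+ 2)).
  move=> a0 a1 an anb nbn; rewrite addrA in anb.
  by field; rewrite a0 a1 an anb nbn.
pose z n : R := (D + (N n)%:R)^-1.
have zcvg : z n @[n --> \oo] --> (0 : R).
  apply/gtr0_cvgV0; first by apply: nearW => n; rewrite ltr_wpDr.
  (* M + N = 2N + e, so M + N >= 2A + e gives N >= A. *)
  apply/cvgryPge => A; move/cvgrnyP : MNoo => /(_ R)/cvgryPge/(_ (2 * A + e)).
  apply: filterS => n; rewrite natrD ME => h.
  have := D0; lra.
pose rho (t : R) := ((1 + e * t) ^+ 2 + (2 + (2 * e - D) * t) * (1 - D * t)) *
  (2 + (e - 2 * D) * t) / (6 * (1 + e * t) ^+ 2).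
have rcvg : rho (z n) @[n --> \oo] --> (1 : R).
  have aff (a b : R) : a + b * z n @[n --> \oo] --> a.
    rewrite [X in _ --> X](_ : _ = a + b * 0); last by ring.
    by apply: cvgD; [exact: cvg_cst|apply: cvgM => //; exact: cvg_cst].
  have sq : (1 + e * z n) ^+ 2 @[n --> \oo] --> (1 : R).
    rewrite -[X in _ --> X](mulr1 1); under eq_fun do rewrite expr2.
    by apply: cvgM; exact: aff.
  rewrite [X in _ --> X](_ : _ = (1 + 2 * 1) * 2 * (6 * 1)^-1); last by field.
  apply: cvgM; last first.
    apply: cvgV; first by rewrite mulr1 pnatr_eq0.
    by apply: cvgM => //; exact: cvg_cst.
  apply: cvgM; last exact: aff.
  apply: cvgD => //; apply: cvgM; first exact: aff.
  under eq_fun do rewrite -mulNr.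
  exact: aff.
apply/eqaddoP => eps eps0.
move/cvgrPdist_le : rcvg => /(_ _ eps0).
(* Eventually M + N >= 1, which keeps the denominator of the equivalent nonzero. *)
move/cvgnyPge : MNoo => /(_ 1%N); apply: filterS2 => n MN1 rle.
pose g : R := 6 * (D - 1) / (D * (D + 1) * ((M n)%:R + (N n)%:R)).
have vE : v_ep R d (N n) (M n) = g * rho (z n).
  rewrite /v_ep /g /rho /z -/D.
  have N0 : D + (N n)%:R != 0 by rewrite gt_eqF// ltr_wpDr.
  have M0 : D + (M n)%:R != 0 by rewrite gt_eqF// ltr_wpDr.
  have D1 : D + 1 != 0 by rewrite gt_eqF// ltr_wpDr.
  have MN0 : (M n)%:R + (N n)%:R != 0 :> R by rewrite -natrD pnatr_eq0 -lt0n.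
  move: D0; rewrite lt0r => /andP[D0 _].
  move: M0 MN0; rewrite ME => M0 MN0.
  exact: alg.
change (`|v_ep R d (N n) (M n) - g| <= eps * `|g|).
(* The error differs from g by g (rho - 1), so no division by g is needed. *)
by rewrite vE -{2}[g]mulr1 -mulrBr normrM mulrC distrC ler_wpM2r.
Qed.

Theorem mainTheorem8 (R : realType) (d : nat) (d_ge2 : (2 <= d)%N) :
  (forall (N M : nat) (mu : probability (borelM R d d) R)
      (ket0 : 'cV[R[i]]_d)
      (disp : measure_display) (T : measurableType disp)
      (P : probability T R)
      (psi phi : {RV P >-> borelM R d 1}) (V : {RV P >-> borelM R d d})
      (x : 'I_N -> {RV P >-> bool}),
    (1 <= N)%N -> (1 <= M)%N ->
    estimate_and_project M mu ket0 psi phi V x ->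
    [/\ forall est : nat -> R,
          optimal_estimator psi phi x est <->
          (forall k, (k <= N)%N -> est k = c_ep R d N M k),
        forall k, (k <= N)%N -> posterior_mean psi phi x k = c_ep R d N M k
      & mean_square_error psi phi x (c_ep R d N M) = (v_ep R d N M)%:E]) /\
  (forall N : nat, (1 <= N)%N ->
    v_ep R d N M @[M --> \oo] -->
      ((d%:R - 1) / (d%:R * (d%:R + 1) * (d%:R + N%:R)) : R)) /\
  (forall (delta : int) (N M : nat -> nat),
    (forall n, (M n)%:Z - (N n)%:Z = delta) ->
    (M n + N n)%N @[n --> \oo] --> \oo ->
    (fun n => v_ep R d (N n) (M n) : R^o) ~_\oo
    (fun n => 6 * (d%:R - 1) /
       (d%:R * (d%:R + 1) * ((M n)%:R + (N n)%:R)) : R^o)).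
Proof.
case: d d_ge2 => [//|[//|d]] _; split=> [|]; last split.
- move=> N M mu ket0 disp T P psi phi V x _ _ H; split.
  + exact: (optimal_estimatorP H).
  + exact: (posterior_meanE H).
  + exact: (mean_square_error_c_ep H).
- by move=> N _; exact: v_ep_cvg_fixed_N.
- by move=> delta N M; exact: v_ep_equiv.
Qed.
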